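(* Let $N\ge2$, $R>0$, let $g:[0,R]\to(0,\infty)$ be smooth, and let $A,B,p,q$ be positive constants with $0<A<B$, all independent of $\epsilon$. For $\epsilon>0$ let $U_\epsilon$ be the unique solution of problem (N* ) and $\rho_\epsilon$ the net charge density, both described in the context. (I) Let $r_\epsilon\in(0,R)$ be such that $\pi_{\beta_0}(\epsilon):=R-r_\epsilon$ satisfies, for some $\beta_0>1$ independent of $\epsilon$: $\lim_{\epsilon\downarrow0}\pi_{\beta_0}(\epsilon)/\epsilon^{\beta'}=0$ for all $\beta'\in(1,\beta_0)$, $\lim_{\epsilon\downarrow0}\pi_{\beta_0}(\epsilon)/\epsilon^{\beta''}=\infty$ for all $\beta''>\beta_0$, and $\lim_{\epsilon\downarrow0}\pi_{\beta_0}(\epsilon)/\epsilon^{\beta_0}\in\{0,\infty\}$. (a) If $\beta_0\in(1,2)$, or if $\beta_0=2$ and $\lim_{\epsilon\downarrow0}\pi_2(\epsilon)/\epsilon^2=\infty$, then as $\epsilon\downarrow0$, $$U_\epsilon(r_\epsilon)=-\frac2q(\beta_0-1)\log\frac1\epsilon+\frac2q\log\frac{\pi_{\beta_0}(\epsilon)}{\epsilon^{\beta_0}}+\frac2q\log\sqrt{\frac{qA}{2g(R)}}+o_\epsilon(1),$$ $$U_\epsilon'(r_\epsilon)=-\frac{2}{q\pi_{\beta_0}(\epsilon)}(1+o_\epsilon(1)),\qquad \rho_\epsilon(r_\epsilon)=\frac{2g(R)}{q}\Big(\frac{\epsilon}{\pi_{\beta_0}(\epsilon)}\Big)^2(1+o_\epsilon(1)).$$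 (b) If $\beta_0>2$, or if $\beta_0=2$ and $\lim_{\epsilon\downarrow0}\pi_2(\epsilon)/\epsilon^2=0$, then as $\epsilon\downarrow0$, $$U_\epsilon(r_\epsilon)=-\frac2q\log\frac1\epsilon+\frac2q\log\Big[\sqrt{\frac{A}{2qg(R)}}\cdot\frac{2Ng(R)}{R(B-A)}\Big]+o_\epsilon(1),$$ $$U_\epsilon'(r_\epsilon)=-\frac{R(B-A)}{Ng(R)}\epsilon^{-2}(1+o_\epsilon(1)),\qquad\rho_\epsilon(r_\epsilon)=\frac{qR^2(B-A)^2}{2N^2g(R)}\epsilon^{-2}(1+o_\epsilon(1)).$$ (II) Let $\Theta\in(0,1)$, $\gamma>0$, $\tau\in\mathbb{R}$ and an integer $n\ge2$ be independent of $\epsilon$, let $\log^{(n)}$ denote the $n$-fold composition of the natural logarithm, and set $$\kappa(\epsilon)=1-\Big(\log\frac1\epsilon\Big)^{-\Theta},\quad \beta_1(\epsilon)=1+\gamma\Big(\log\frac1\epsilon\Big)^{-\Theta},\quad\beta_2(\epsilon)=1+\Big(\log\frac1\epsilon\Big)^{-1}\Big(\gamma\log^{(n)}\frac1\epsilon+\tau\Big).$$ Then for any fixed $\kappa\in(0,1)$ and $\beta>1$, the points $R-\epsilon^{\kappa(\epsilon)}$ and $R-\epsilon^{\beta_i(\epsilon)}$ ($i=1,2$) lie in $[R-\epsilon^\kappa,R-\epsilon^\beta]$ for all sufficiently small $\epsilon>0$, and as $\epsilon\downarrow0$, $$\lim_{\epsilon\downarrow0}|U_\epsilon(R-\epsilon^{\kappa(\epsilon)})|=\lim_{\epsilon\downarrow0}|U_\epsilon'(R-\epsilon^{\kappa(\epsilon)})|=0,$$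 $$U_\epsilon(R-\epsilon^{\beta_1(\epsilon)})=-\frac{2\gamma}{q}\Big(\log\frac1\epsilon\Big)^{1-\Theta}+\frac1q\log\frac{qA}{2g(R)}+o_\epsilon(1),$$ $$U_\epsilon(R-\epsilon^{\beta_2(\epsilon)})=-\frac{2\gamma}{q}\log^{(n)}\frac1\epsilon+\frac1q\Big(-2\tau+\log\frac{qA}{2g(R)}\Big)+o_\epsilon(1),$$ $$U_\epsilon'(R-\epsilon^{\beta_1(\epsilon)})=-\frac2q\epsilon^{-\beta_1(\epsilon)}(1+o_\epsilon(1)),\qquad\rho_\epsilon(R-\epsilon^{\beta_1(\epsilon)})=\frac{2g(R)}{q}\epsilon^{-2(\beta_1(\epsilon)-1)}(1+o_\epsilon(1)),$$ and, if $n=2$ and $\gamma>2$, $$U_\epsilon'(R-\epsilon^{\beta_2(\epsilon)})=-\frac2q\epsilon^{-\beta_2(\epsilon)}(1+o_\epsilon(1)),\qquad\rho_\epsilon(R-\epsilon^{\beta_2(\epsilon)})=\frac{2g(R)}{q}\epsilon^{-2(\beta_2(\epsilon)-1)}(1+o_\epsilon(1)).$$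
   Context: Problem (N* ): for $\epsilon>0$, find $U_\epsilon\in C^1([0,R])\cap C^\infty((0,R))$ such that for $r\in(0,R)$ $$\epsilon^2 g(r)\Big[U_\epsilon''(r)+\Big(\frac{N-1}{r}+\frac{g'(r)}{g(r)}\Big)U_\epsilon'(r)\Big]=\frac{R^N}{N}\Big(\frac{Ae^{pU_\epsilon(r)}}{\int_0^R s^{N-1}e^{pU_\epsilon(s)}ds}-\frac{Be^{-qU_\epsilon(r)}}{\int_0^R s^{N-1}e^{-qU_\epsilon(s)}ds}\Big),$$ together with $\int_0^R s^{N-1}U_\epsilon(s)\,ds=0$, $U_\epsilon'(0)=0$ and $U_\epsilon'(R)=\frac{R(A-B)}{\epsilon^2Ng(R)}$; it has a unique solution. The net charge density is $\rho_\epsilon(r)=-\frac{R^N}{N}\big(\frac{Ae^{pU_\epsilon(r)}}{\int_0^Rs^{N-1}e^{pU_\epsilon(s)}ds}-\frac{Be^{-qU_\epsilon(r)}}{\int_0^Rs^{N-1}e^{-qU_\epsilon(s)}ds}\big)$. Notation: $o_\epsilon(1)$ denotes a quantity tending to $0$ as $\epsilon\downarrow0$. *)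

(* Defs.v *)
From Stdlib Require Import Reals Lra.
From Coquelicot Require Import Coquelicot.
Open Scope R_scope.

Definition tends0 (f : R -> R) : Prop :=
  filterlim f (at_right 0) (locally 0).

Definition tendsinf (f : R -> R) : Prop :=
  filterlim f (at_right 0) (Rbar_locally p_infty).

Definition smooth (f : R -> R) : Prop := forall (n : nat) (x : R), ex_derive_n f n x.

Definition iter_ln (n : nat) (x : R) : R := Nat.iter n ln x.

Definition Ip (N : nat) (Rad p : R) (u : R -> R) : R :=
  RInt (fun s => s ^ (N - 1) * exp (p * u s)) 0 Rad.
Definition Iq (N : nat) (Rad q : R) (u : R -> R) : R :=
  RInt (fun s => s ^ (N - 1) * exp (- q * u s)) 0 Rad.

Definition Nrhs (N : nat) (Rad A B p q : R) (u : R -> R) (r : R) : R :=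
  Rad ^ N / INR N *
  (A * exp (p * u r) / Ip N Rad p u - B * exp (- q * u r) / Iq N Rad q u).

Definition rho (N : nat) (Rad A B p q : R) (u : R -> R) (r : R) : R :=
  - Nrhs N Rad A B p q u r.

Definition solves_Nstar (N : nat) (Rad : R) (g : R -> R) (A B p q eps : R)
    (u : R -> R) : Prop :=
  exists du : R -> R,
    (forall x, 0 < x < Rad -> is_derive u x (du x)) /\
    filterlim (fun h => (u (0 + h) - u 0) / h) (at_right 0) (locally (du 0)) /\
    filterlim (fun h => (u (Rad + h) - u Rad) / h) (at_left 0) (locally (du Rad)) /\
    continuous_on (fun x => 0 <= x <= Rad) du /\
    (forall (n : nat) x, 0 < x < Rad -> ex_derive_n u n x) /\
    (forall r, 0 < r < Rad ->
       eps ^ 2 * g r *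
         (Derive_n u 2 r + ((INR N - 1) / r + Derive g r / g r) * Derive u r)
       = Nrhs N Rad A B p q u r) /\
    RInt (fun s => s ^ (N - 1) * u s) 0 Rad = 0 /\
    du 0 = 0 /\
    du Rad = Rad * (A - B) / (eps ^ 2 * INR N * g Rad).

(* Main.v *)
Require Import Defs.
From Stdlib Require Import Reals Lra Lia.
From Coquelicot Require Import Coquelicot.
Open Scope R_scope.

(* Put V = c - U, where c is the constant solution of the equation; then V >= 0
   is increasing, with flux w = r^(N-1) g V' satisfying
   eps^2 w' = r^(N-1) K (exp (q V) - exp (- p V)).
   Since w' dominates V and V' dominates w, the quantity V + eps w decays like
   exp (- l (R - r) / eps) away from the wall. The integral constraints then
   force c -> 0 and K -> A. Multiplying the equation by w and integrating gives,
   near the wall, eps^2 V'^2 = (2 A / g(R)) G(V) up to a small relative error,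
   with G' = exp (q V) - exp (- p V). In terms of Y = exp (- q V / 2) this says
   that - eps Y' tends to m = sqrt (q A / (2 g(R))) wherever Y is small, i.e. at
   distances R - r = o(eps) from the wall, so
   Y(r) = Y(R) + m (1 + o(1)) (R - r) / eps, and the boundary condition gives
   Y(R) ~ const * eps. The cases eps^2 << R - r << eps and R - r << eps^2
   correspond to which of the two terms dominates. *)

(** * Calculus on an interval *)

(** The coefficients of the equation contain integrals of the unknown, and V is unbounded at the
    wall as eps tends to 0, so no limit profile is available beforehand. Every estimate is therefore
    proved for an arbitrary [layer], with thresholds depending on the data alone, and only
    afterwards specialised to the family. The level c is controlled because c times the ball mass is
    the weighted integral of V: decay makes V small inside, and in a thin collar the anion integral
    dominates V. The bounds 1 - p V <= exp (- p V) <= 1 then pin K. The multiplier is w rather than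
    V' because w w' contains no first-order term; what remains is the factor r^(2N-2) g, which is
    nearly constant near the wall. Errors in the resulting energy relation can only be relative, of
    size t (1 + G(V)); multiplying by Y^2 makes them bounded, since Y^2 G(V) is bounded. The
    constant in Y(R) comes from - eps Y' = (q/2) eps V' Y: the condition at the wall prescribes
    eps^2 V'(R), so Y(R) is a fixed multiple of eps times - eps Y'(R), which tends to m. *)

(** The equation is given only for 0 < r < R, so derivatives are asked for on the open interval and
    continuity up to its ends. *)
Lemma MVT_open (f df : R -> R) (a b : R) :
  a < b ->
  (forall x, a <= x <= b -> continuous f x) ->
  (forall x, a < x < b -> is_derive f x (df x)) ->
  exists c, a < c < b /\ f b - f a = df c * (b - a).
Proof.
intros Hab Hc Hd.
assert (pr1 : forall x, a < x < b -> derivable_pt f x).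
{ intros x Hx; exists (df x); now apply is_derive_Reals, Hd. }
assert (pr2 : forall x, a < x < b -> derivable_pt id x).
{ intros x _; apply derivable_pt_id. }
destruct (MVT f id a b pr1 pr2 Hab) as (c & Hcab & E).
{ intros x Hx; now apply continuity_pt_filterlim, Hc. }
{ intros x _; apply derivable_continuous_pt, derivable_pt_id. }
exists c; split; [exact Hcab|].
assert (E1 : derive_pt f c (pr1 c Hcab) = df c).
{ apply derive_pt_eq_0, is_derive_Reals, Hd, Hcab. }
assert (E2 : derive_pt id c (pr2 c Hcab) = 1).
{ apply derive_pt_eq_0, derivable_pt_lim_id. }
rewrite E1, E2 in E; unfold id in E; lra.
Qed.

Lemma nondecreasing_of_derive (f df : R -> R) (a b : R) :
  a <= b ->
  (forall x, a <= x <= b -> continuous f x) ->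
  (forall x, a < x < b -> is_derive f x (df x)) ->
  (forall x, a < x < b -> 0 <= df x) ->
  f a <= f b.
Proof.
intros [Hab| ->] Hc Hd Hp; [|lra].
destruct (MVT_open f df a b Hab Hc Hd) as (c & Hcab & E).
specialize (Hp c Hcab); nra.
Qed.

(** Composition with [clamp] extends a function on [a,b] by its end values. Relative continuity on
    the interval becomes continuity on the line, so integrals and products need no domain
    conditions. *)
Definition clamp (a b x : R) : R := Rmax a (Rmin b x).

Lemma clamp_in (a b x : R) : a <= b -> a <= clamp a b x <= b.
Proof.
intros H; unfold clamp, Rmax, Rmin; repeat destruct Rle_dec; lra.
Qed.

Lemma clamp_id (a b x : R) : a <= x <= b -> clamp a b x = x.
Proof.
intros H; unfold clamp, Rmax, Rmin; repeat destruct Rle_dec; lra.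
Qed.

Lemma clamp_continuous (a b x : R) : continuous (clamp a b) x.
Proof.
apply filterlim_locally; intros e; exists e; intros y Hy.
unfold ball in *; simpl in *; unfold AbsRing_ball, abs, minus, plus, opp in *; simpl in *.
unfold clamp, Rmax, Rmin, Rabs in *.
repeat destruct Rle_dec; repeat destruct Rcase_abs; lra.
Qed.

Lemma continuous_on_clamp (a b : R) (f : R -> R) (x : R) :
  a <= b -> continuous_on (fun y => a <= y <= b) f ->
  continuous (fun y => f (clamp a b y)) x.
Proof.
intros Hab Hf.
apply (filterlim_comp _ _ _ (clamp a b) f (locally x)
         (within (fun y => a <= y <= b) (locally (clamp a b x)))).
- intros P HP; generalize (clamp_continuous a b x _ HP).
  unfold filtermap; apply (filter_imp (F := locally x)); intros y Hy; apply Hy, clamp_in, Hab.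
- apply Hf, clamp_in, Hab.
Qed.

(** A convergent difference quotient is eventually bounded by |l| + 1, which gives a Lipschitz bound
    at x. This yields the continuity of a solution at 0 and at R, where only one-sided derivatives
    are known. *)
Lemma continuous_within_of_quotient (D : R -> Prop) (f : R -> R) (x l : R) :
  filterlim (fun h => (f (x + h) - f x) / h)
    (within (fun h => h <> 0 /\ D (x + h)) (locally 0)) (locally l) ->
  filterlim f (within D (locally x)) (locally (f x)).
Proof.
intros H.
apply filterlim_locally; intros e.
assert (H1 := proj1 (filterlim_locally _ _) H (mkposreal 1 Rlt_0_1)).
destruct H1 as [d Hd].
assert (Hl : 0 < Rabs l + 1) by (generalize (Rabs_pos l); lra).
assert (Hm : 0 < Rmin d (e / (Rabs l + 1))).
{ apply Rmin_pos; [apply cond_pos|apply Rdiv_lt_0_compat; [apply cond_pos|exact Hl]]. }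
exists (mkposreal _ Hm); intros y Hy HDy.
change (Rabs (y - x) < Rmin d (e / (Rabs l + 1))) in Hy.
change (Rabs (f y - f x) < e).
destruct (Req_dec y x) as [->|Hn].
{ rewrite Rminus_diag, Rabs_R0; apply cond_pos. }
assert (Hq : Rabs ((f (x + (y - x)) - f x) / (y - x) - l) < 1).
{ apply Hd.
  - change (Rabs (y - x - 0) < d); rewrite Rminus_0_r.
    apply Rlt_le_trans with (1 := Hy), Rmin_l.
  - split; [now apply Rminus_eq_contra|]; rewrite Rplus_minus; exact HDy. }
rewrite Rplus_minus in Hq.
assert (Hy2 : Rabs (y - x) < e / (Rabs l + 1))
  by (apply Rlt_le_trans with (1 := Hy), Rmin_r).
set (Q := (f y - f x) / (y - x)) in *.
assert (HQ : Rabs Q < Rabs l + 1).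
{ replace Q with ((Q - l) + l) by ring.
  apply Rle_lt_trans with (1 := Rabs_triang _ _); lra. }
replace (f y - f x) with (Q * (y - x)) by (unfold Q; field; now apply Rminus_eq_contra).
rewrite Rabs_mult.
apply Rle_lt_trans with ((Rabs l + 1) * Rabs (y - x)).
{ apply Rmult_le_compat_r; [apply Rabs_pos|lra]. }
apply Rlt_le_trans with ((Rabs l + 1) * (e / (Rabs l + 1))).
{ apply Rmult_lt_compat_l; assumption. }
right; field; lra.
Qed.

(* [w V] and then [w ^ 2] are nondecreasing; since [w] ends positive it never was negative. *)
Lemma flux_and_profile_nonneg (Rad : R) (V dV s k F : R -> R) :
  0 < Rad ->
  (forall x, continuous V x) -> (forall x, continuous dV x) ->
  (forall x, continuous s x) ->
  (forall x, 0 < x <= Rad -> 0 < s x) ->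
  (forall x, 0 < x < Rad -> 0 < k x) ->
  F 0 = 0 -> (forall y, 0 < y -> 0 < F y) -> (forall y, y < 0 -> F y < 0) ->
  (forall x, 0 < x < Rad -> is_derive V x (dV x)) ->
  (forall x, 0 < x < Rad -> is_derive (fun r => s r * dV r) x (k x * F (V x))) ->
  s 0 * dV 0 = 0 -> 0 < dV Rad ->
  forall x, 0 < x <= Rad -> 0 <= V x /\ 0 <= dV x.
Proof.
intros HR cV cdV cs sp kp F0 Fp Fn HdV Hdw w0 wR.
set (w := fun r => s r * dV r) in *.
assert (cw : forall x, continuous w x).
{ intros x; apply (continuous_mult s dV); auto. }
assert (H1 : forall x, 0 <= x <= Rad -> 0 <= w x * V x).
{ intros x Hx.
  replace 0 with (w 0 * V 0) by (unfold w; rewrite w0; ring).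
  apply (nondecreasing_of_derive (fun r => w r * V r)
    (fun r => k r * F (V r) * V r + w r * dV r)); [lra| | |].
  - intros y _; apply (continuous_mult w V); auto.
  - intros y Hy; apply (is_derive_mult w V); [apply Hdw; lra|apply HdV; lra|].
    intros; apply Rmult_comm.
  - intros y Hy.
    assert (0 <= w y * dV y).
    { unfold w. assert (0 < s y) by (apply sp; lra). nra. }
    assert (0 <= F (V y) * V y).
    { destruct (Rtotal_order (V y) 0) as [h|[h|h]].
      - specialize (Fn _ h); nra.
      - rewrite h; lra.
      - specialize (Fp _ h); nra. }
    assert (0 < k y) by (apply kp; lra). nra. }
assert (H2 : forall x, 0 <= x <= Rad -> 0 <= w x * F (V x)).
{ intros x Hx; specialize (H1 x Hx).
  destruct (Rtotal_order (V x) 0) as [h|[h|h]].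
  - specialize (Fn _ h); assert (w x <= 0) by nra; nra.
  - rewrite h, F0; lra.
  - specialize (Fp _ h); assert (0 <= w x) by nra; nra. }
assert (H3 : forall x y, 0 <= x -> x <= y -> y <= Rad -> w x * w x <= w y * w y).
{ intros x y Hx Hxy Hy.
  apply (nondecreasing_of_derive (fun r => w r * w r)
    (fun r => k r * F (V r) * w r + w r * (k r * F (V r)))); [lra| | |].
  - intros z _; apply (continuous_mult w w); auto.
  - intros z Hz; apply (is_derive_mult w w); [apply Hdw; lra|apply Hdw; lra|].
    intros; apply Rmult_comm.
  - intros z Hz. assert (0 < k z) by (apply kp; lra).
    assert (0 <= w z * F (V z)) by (apply H2; lra). nra. }
assert (wRp : 0 < w Rad).
{ unfold w. assert (0 < s Rad) by (apply sp; lra). nra. }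
assert (H4 : forall x, 0 <= x <= Rad -> 0 <= w x).
{ intros x Hx; destruct (Rle_lt_dec 0 (w x)) as [h|h]; [exact h|exfalso].
  destruct (IVT_gen w x Rad 0) as (z & Hz & Ez).
  - intros y; apply continuity_pt_filterlim, cw.
  - rewrite Rmin_left, Rmax_right; lra.
  - rewrite Rmin_left, Rmax_right in Hz by lra.
    assert (w x * w x <= w z * w z) by (apply H3; lra).
    rewrite Ez in *; nra. }
assert (H5 : forall x, 0 < x <= Rad -> 0 <= dV x).
{ intros x Hx. assert (0 <= w x) by (apply H4; lra).
  assert (0 < s x) by (apply sp; lra). unfold w in *.
  destruct (Rle_lt_dec 0 (dV x)); [assumption|nra]. }
intros x Hx; split; [|now apply H5].
(* If V x < 0, monotonicity makes V negative on all of (0, x), so w has negative derivative there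
   and falls below w 0 = 0, contradicting w >= 0. *)
destruct (Rle_lt_dec 0 (V x)) as [h|h]; [exact h|exfalso].
destruct (MVT_open w (fun r => k r * F (V r)) 0 x) as (z & Hz & Ez).
{ lra. }
{ intros; apply cw. }
{ intros y Hy; apply Hdw; lra. }
assert (Vz : V z <= V x).
{ apply (nondecreasing_of_derive V dV); [lra|auto| |].
  - intros y Hy; apply HdV; lra.
  - intros y Hy; apply H5; lra. }
assert (F (V z) < 0) by (apply Fn; lra).
assert (0 < k z) by (apply kp; lra).
assert (0 <= w x) by (apply H4; lra).
assert (w 0 = 0) by exact w0.
assert (k z * F (V z) < 0) by nra.
nra.
Qed.

Lemma exp_nondecreasing (x y : R) : x <= y -> exp x <= exp y.
Proof. intros [H| ->]; [now apply Rlt_le, exp_increasing|apply Rle_refl]. Qed.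

Lemma exp_ge_square (y : R) : 0 <= y -> y ^ 2 / 4 <= exp y.
Proof.
intros Hy; replace (exp y) with (exp (y / 2) * exp (y / 2))
  by (rewrite <- exp_plus; f_equal; field).
assert (1 + y / 2 <= exp (y / 2)) by apply exp_ineq1_le; nra.
Qed.

Ltac pos := repeat (first [assumption | lra | apply Rdiv_lt_0_compat
  | apply Rmult_lt_0_compat | apply pow_lt | apply Rinv_0_lt_compat]).

(** * Limits as the parameter tends to zero *)

(** For l = 0 this is [tends0] by conversion, so the limits obtained below serve directly as
    conclusions of the theorem. *)
Definition lim0 (f : R -> R) (l : R) : Prop := filterlim f (at_right 0) (locally l).

Lemma lim0_intro (f : R -> R) (l : R) :
  (forall eta, 0 < eta -> at_right 0 (fun e => Rabs (f e - l) <= eta)) -> lim0 f l.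
Proof.
intros H; apply filterlim_locally; intros eta.
assert (He := cond_pos eta).
generalize (H (eta / 2) ltac:(lra)); apply filter_imp; intros e Hf.
change (Rabs (f e - l) < eta); lra.
Qed.

Lemma lim0_elim (f : R -> R) (l eta : R) : lim0 f l -> 0 < eta ->
  at_right 0 (fun e => Rabs (f e - l) < eta).
Proof.
intros H He; exact (proj1 (filterlim_locally _ _) H (mkposreal eta He)).
Qed.

Lemma at_right_pos : at_right 0 (fun e => 0 < e).
Proof. exists (mkposreal 1 Rlt_0_1); intros y _ Hy; exact Hy. Qed.

Lemma at_right_lt (e0 : R) : 0 < e0 -> at_right 0 (fun e => e < e0).
Proof.
intros H; exists (mkposreal e0 H); intros y Hy Hy0.
change (Rabs (y - 0) < e0) in Hy; rewrite Rminus_0_r in Hy.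
apply Rle_lt_trans with (1 := Rle_abs y), Hy.
Qed.

Lemma lim0_ext (f h : R -> R) (l : R) :
  at_right 0 (fun e => f e = h e) -> lim0 f l -> lim0 h l.
Proof. intros H; now apply filterlim_ext_loc. Qed.

Lemma lim0_comp (phi f : R -> R) (l : R) :
  continuous phi l -> lim0 f l -> lim0 (fun e => phi (f e)) (phi l).
Proof. intros Hphi Hf; exact (filterlim_comp _ _ _ _ _ _ _ _ Hf Hphi). Qed.

Lemma lim0_const (k : R) : lim0 (fun _ => k) k.
Proof. apply filterlim_const. Qed.

Lemma lim0_plus (f h : R -> R) (a b : R) :
  lim0 f a -> lim0 h b -> lim0 (fun e => f e + h e) (a + b).
Proof.
intros Hf Hh; exact (filterlim_comp_2 _ _ _ Hf Hh (filterlim_plus (V := R_NormedModule) a b)).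
Qed.

Lemma lim0_mult (f h : R -> R) (a b : R) :
  lim0 f a -> lim0 h b -> lim0 (fun e => f e * h e) (a * b).
Proof.
intros Hf Hh; exact (filterlim_comp_2 _ _ _ Hf Hh (filterlim_mult (K := R_AbsRing) a b)).
Qed.

Lemma lim0_scal (k : R) (f : R -> R) (a : R) :
  lim0 f a -> lim0 (fun e => k * f e) (k * a).
Proof. apply lim0_mult, lim0_const. Qed.

Lemma lim0_minus (f h : R -> R) (a b : R) :
  lim0 f a -> lim0 h b -> lim0 (fun e => f e - h e) (a - b).
Proof.
intros Hf Hh; apply lim0_ext with (fun e => f e + -1 * h e).
{ apply filter_forall; intros; ring. }
replace (a - b) with (a + -1 * b) by ring.
apply lim0_plus; [exact Hf|now apply lim0_scal].
Qed.

Lemma lim0_div (f h : R -> R) (a b : R) : b <> 0 ->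
  lim0 f a -> lim0 h b -> lim0 (fun e => f e / h e) (a / b).
Proof.
intros Hb Hf Hh; apply lim0_mult; [exact Hf|].
now apply (lim0_comp Rinv); [apply continuous_Rinv|].
Qed.

Lemma lim0_squeeze (f h : R -> R) :
  at_right 0 (fun e => Rabs (f e) <= h e) -> lim0 h 0 -> lim0 f 0.
Proof.
intros Hb Hh; apply lim0_intro; intros eta Heta.
generalize (filter_and (F := at_right 0) _ _ Hb (lim0_elim _ _ _ Hh Heta)); apply filter_imp.
intros e [H1 H2]; rewrite Rminus_0_r in *; generalize (Rle_abs (h e)); lra.
Qed.

Lemma tendsinf_elim (f : R -> R) (M : R) : tendsinf f -> at_right 0 (fun e => M < f e).
Proof. intros H; apply H; exists M; intros; assumption. Qed.

Lemma tendsinf_intro (f : R -> R) :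
  (forall M, at_right 0 (fun e => M < f e)) -> tendsinf f.
Proof.
intros H P [M HM]; generalize (H M); unfold filtermap; apply filter_imp; intros; now apply HM.
Qed.

Lemma tendsinf_comp (phi f : R -> R) :
  filterlim phi (Rbar_locally p_infty) (Rbar_locally p_infty) ->
  tendsinf f -> tendsinf (fun e => phi (f e)).
Proof. intros Hphi Hf; exact (filterlim_comp _ _ _ _ _ _ _ _ Hf Hphi). Qed.

Lemma lim0_comp_inf (phi f : R -> R) (l : R) :
  filterlim phi (Rbar_locally p_infty) (locally l) ->
  tendsinf f -> lim0 (fun e => phi (f e)) l.
Proof. intros Hphi Hf; exact (filterlim_comp _ _ _ _ _ _ _ _ Hf Hphi). Qed.

Lemma tendsinf_le (f h : R -> R) :
  at_right 0 (fun e => f e <= h e) -> tendsinf f -> tendsinf h.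
Proof.
intros Hfh Hf; apply tendsinf_intro; intros M.
generalize (filter_and (F := at_right 0) _ _ Hfh (tendsinf_elim f M Hf)); apply filter_imp; intros e He; lra.
Qed.

Lemma tendsinf_ext (f h : R -> R) :
  at_right 0 (fun e => f e = h e) -> tendsinf f -> tendsinf h.
Proof.
intros H; apply tendsinf_le; revert H; apply filter_imp; intros; lra.
Qed.

Lemma tendsinf_mult (f h : R -> R) (l : R) : 0 < l ->
  lim0 h l -> tendsinf f -> tendsinf (fun e => h e * f e).
Proof.
intros Hl Hh Hf; apply tendsinf_intro; intros M.
generalize (filter_and (F := at_right 0) _ _ (lim0_elim h l (l / 2) Hh ltac:(lra))
  (tendsinf_elim f (2 * Rabs M / l) Hf)); apply filter_imp; intros e [H1 H2].
apply Rabs_lt_between in H1.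
assert (H0 := Rabs_pos M).
assert (0 <= 2 * Rabs M / l) by (apply Rmult_le_pos; [lra|apply Rlt_le, Rinv_0_lt_compat, Hl]).
apply Rle_lt_trans with (1 := Rle_abs M).
apply Rle_lt_trans with (l / 2 * (2 * Rabs M / l)); [right; field; lra|].
apply Rlt_le_trans with (l / 2 * f e); [apply Rmult_lt_compat_l; lra|].
apply Rmult_le_compat_r; lra.
Qed.

Lemma lim0_inv_inf (f : R -> R) : tendsinf f -> lim0 (fun e => / f e) 0.
Proof.
intros Hf; apply lim0_intro; intros eta Heta.
generalize (tendsinf_elim f (/ eta) Hf); apply filter_imp; intros e He.
assert (0 < / eta) by now apply Rinv_0_lt_compat.
rewrite Rminus_0_r, Rabs_pos_eq by (apply Rlt_le, Rinv_0_lt_compat; lra).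
rewrite <- (Rinv_inv eta); apply Rinv_le_contravar; lra.
Qed.

Lemma filterlim_exp_infty : filterlim exp (Rbar_locally p_infty) (Rbar_locally p_infty).
Proof. exact is_lim_exp_p. Qed.

Lemma filterlim_ln_infty : filterlim ln (Rbar_locally p_infty) (Rbar_locally p_infty).
Proof. exact is_lim_ln_p. Qed.

Lemma lim0_exp_opp (f : R -> R) : tendsinf f -> lim0 (fun e => exp (- f e)) 0.
Proof.
intros Hf; apply lim0_ext with (fun e => / exp (f e)).
{ apply filter_forall; intros; symmetry; apply exp_Ropp. }
apply lim0_inv_inf, tendsinf_comp; [exact filterlim_exp_infty|exact Hf].
Qed.

Lemma tendsinf_log_inv : tendsinf (fun e => ln (1 / e)).
Proof.
apply tendsinf_comp; [exact filterlim_ln_infty|].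
apply tendsinf_intro; intros M.
assert (HM : 0 < / (Rabs M + 1)) by (apply Rinv_0_lt_compat; generalize (Rabs_pos M); lra).
generalize (filter_and (F := at_right 0) _ _ at_right_pos (at_right_lt _ HM)); apply filter_imp; intros e [H1 H2].
apply Rle_lt_trans with (1 := Rle_abs M).
apply Rlt_trans with (Rabs M + 1); [lra|].
unfold Rdiv; rewrite Rmult_1_l, <- (Rinv_inv (Rabs M + 1)).
apply Rinv_lt_contravar; [now apply Rmult_lt_0_compat|exact H2].
Qed.

Lemma lim0_Rpower (a : R) : 0 < a -> lim0 (fun e => Rpower e a) 0.
Proof.
intros Ha; apply lim0_ext with (fun e => exp (- (a * ln (1 / e)))).
{ generalize at_right_pos; apply filter_imp; intros e He.
  unfold Rpower, Rdiv; rewrite Rmult_1_l, ln_Rinv by exact He; f_equal; ring. }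
apply lim0_exp_opp, (tendsinf_mult _ _ a Ha (lim0_const a) tendsinf_log_inv).
Qed.

Lemma lim0_id : lim0 (fun e => e) 0.
Proof.
apply lim0_intro; intros eta He.
generalize (filter_and (F := at_right 0) _ _ at_right_pos (at_right_lt eta He)); apply filter_imp.
intros e [H1 H2]; rewrite Rminus_0_r, Rabs_pos_eq; lra.
Qed.

(** * Logarithmic scales *)

Lemma ln_opp_log_inv (e : R) : 0 < e -> ln e = - ln (1 / e).
Proof.
intros He; unfold Rdiv; rewrite Rmult_1_l, ln_Rinv by exact He; ring.
Qed.

Lemma log_inv_pos : at_right 0 (fun e => 0 < e /\ 0 < ln (1 / e)).
Proof.
apply (filter_and (F := at_right 0)); [exact at_right_pos|].
exact (tendsinf_elim _ 0 tendsinf_log_inv).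
Qed.

Lemma log_power_inf (k : R) : 0 < k -> tendsinf (fun e => Rpower (ln (1 / e)) k).
Proof.
intros Hk; unfold Rpower; apply tendsinf_comp; [exact filterlim_exp_infty|].
apply tendsinf_mult with k; [exact Hk|apply lim0_const|].
apply tendsinf_comp; [exact filterlim_ln_infty|exact tendsinf_log_inv].
Qed.

Lemma log_power_lim (k : R) : 0 < k -> lim0 (fun e => Rpower (ln (1 / e)) (- k)) 0.
Proof.
intros Hk; apply lim0_ext with (fun e => / Rpower (ln (1 / e)) k).
{ apply filter_forall; intros; symmetry; apply Rpower_Ropp. }
apply lim0_inv_inf, log_power_inf, Hk.
Qed.

Lemma iter_ln_inf (n : nat) : tendsinf (fun e => iter_ln n (1 / e)).
Proof.
induction n as [|n IH].
- apply tendsinf_ext with (fun e => exp (ln (1 / e))).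
  { generalize at_right_pos; apply filter_imp; intros e He; apply exp_ln; pos. }
  apply tendsinf_comp; [exact filterlim_exp_infty|exact tendsinf_log_inv].
- apply (tendsinf_comp ln); [exact filterlim_ln_infty|exact IH].
Qed.

(** For n = 2 this is ln y / y at y = ln (1 / e). A further logarithm only shrinks the numerator,
    since 0 <= ln z <= z once z > 1. *)
Lemma iter_ln_small (n : nat) : (2 <= n)%nat ->
  lim0 (fun e => iter_ln n (1 / e) / ln (1 / e)) 0.
Proof.
intros Hn; induction Hn as [|n Hn IH].
- apply (lim0_comp_inf (fun y => ln y / y)); [exact is_lim_div_ln_p|exact tendsinf_log_inv].
- apply lim0_squeeze with (2 := IH).
  generalize (filter_and (F := at_right 0) _ _ log_inv_pos (tendsinf_elim _ 1 (iter_ln_inf n))).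
  apply filter_imp; intros e [[He HL] H].
  set (z := iter_ln n (1 / e)) in *.
  change (iter_ln (S n) (1 / e)) with (ln z).
  assert (0 <= ln z) by (rewrite <- ln_1; apply ln_le; lra).
  assert (ln z <= z) by (generalize (exp_ineq1_le (ln z)); rewrite exp_ln; lra).
  assert (0 < / ln (1 / e)) by now apply Rinv_0_lt_compat.
  unfold Rdiv at 1 3; rewrite Rabs_pos_eq; [|apply Rmult_le_pos; lra].
  apply Rmult_le_compat_r; lra.
Qed.

(** With L = ln (1 / e) and s = L^k, the quantity exp s outgrows every multiple of L because ln L =
    o(s); hence exp (- l exp s) beats e^(-2) = exp (2 L). It serves the interior point, whose
    distance to the wall is e times exp s with k = 1 - Theta. *)
Lemma exp_log_power_dominates (k l : R) : 0 < k < 1 -> 0 < l ->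
  lim0 (fun e => exp (- l * exp (Rpower (ln (1 / e)) k)) / e ^ 2) 0.
Proof.
intros Hk Hl.
set (L := fun e => ln (1 / e)); set (s := fun e => Rpower (L e) k).
assert (Hs : tendsinf s) by (apply log_power_inf; lra).
(* Since ln s = k ln L, the quotient is (1/k) ln s / s. *)
assert (H1 : lim0 (fun e => ln (L e) / s e) 0).
{ apply lim0_ext with (fun e => / k * (ln (s e) / s e)).
  { apply filter_forall; intros e; unfold s at 1, Rpower; rewrite ln_exp.
    assert (0 < s e) by apply exp_pos. field; lra. }
  replace 0 with (/ k * 0) by ring; apply lim0_scal.
  apply (lim0_comp_inf (fun y => ln y / y)); [exact is_lim_div_ln_p|exact Hs]. }
assert (H2 : tendsinf (fun e => exp ((1 - ln (L e) / s e) * s e))).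
{ apply tendsinf_comp; [exact filterlim_exp_infty|].
  apply tendsinf_mult with (1 - 0); [lra| |exact Hs].
  apply lim0_minus; [apply lim0_const|exact H1]. }
apply lim0_ext with (fun e => exp (- (l * exp (s e) - 2 * L e))).
{ generalize at_right_pos; apply filter_imp; intros e He.
  replace (e ^ 2) with (exp (- (2 * L e))).
  - change (exp (- (l * exp (s e) - 2 * L e)) = exp (- l * exp (s e)) / exp (- (2 * L e))).
    unfold Rdiv; rewrite <- exp_Ropp, <- exp_plus; f_equal; ring.
  - transitivity (exp (ln e) ^ 2); [|now rewrite exp_ln].
    rewrite (ln_opp_log_inv e He); simpl; rewrite Rmult_1_r, <- exp_plus; f_equal; unfold L; ring. }
apply lim0_exp_opp, tendsinf_le with (2 := tendsinf_log_inv).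
generalize (filter_and (F := at_right 0) _ _ log_inv_pos (tendsinf_elim _ (3 / l) H2)).
apply filter_imp; intros e [[He HL] H]; fold (L e) in HL; fold (L e).
assert (Hse : 0 < s e) by apply exp_pos.
replace ((1 - ln (L e) / s e) * s e) with (s e - ln (L e)) in H by (field; lra).
assert (E : exp (s e) = exp (s e - ln (L e)) * L e).
{ rewrite <- (exp_ln (L e)) at 2 by exact HL; rewrite <- exp_plus; f_equal; ring. }
rewrite E.
(* The value 3 leaves l exp s - 2 L >= L, which tends to infinity. *)
assert (3 <= l * exp (s e - ln (L e))).
{ apply Rle_trans with (l * (3 / l)); [right; field; lra|apply Rmult_le_compat_l; lra]. }
nra.
Qed.

(** Raising e to the power phi / ln (1 / e) gives exp (- phi). Exponents close to 1 thus become
    stretched distances exp (- phi), measured in units of e. *)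
Lemma Rpower_exponent (b phi e : R) : 0 < e -> 0 < ln (1 / e) ->
  b = 1 + phi / ln (1 / e) -> Rpower e b = e * exp (- phi).
Proof.
intros He HL ->; unfold Rpower.
transitivity (exp (ln e) * exp (- phi)); [|now rewrite exp_ln].
rewrite <- exp_plus, (ln_opp_log_inv e He).
f_equal; field; lra.
Qed.

Lemma Rpower_between (Rad kappa b beta e : R) : 0 < e -> 0 < ln (1 / e) ->
  kappa < b < beta ->
  Rad - Rpower e kappa <= Rad - Rpower e b <= Rad - Rpower e beta.
Proof.
intros He HL Hb; unfold Rpower; rewrite (ln_opp_log_inv e He).
assert (exp (b * - ln (1 / e)) <= exp (kappa * - ln (1 / e))) by (apply exp_nondecreasing; nra).
assert (exp (beta * - ln (1 / e)) <= exp (b * - ln (1 / e))) by (apply exp_nondecreasing; nra).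
lra.
Qed.

(** * The boundary layer profile *)

Section BoundaryLayer.

Variables (N : nat) (Rad : R) (g : R -> R) (A B p q : R).
Hypotheses (HN : (2 <= N)%nat) (HR : 0 < Rad) (Hg : smooth g)
  (Hgpos : forall x, 0 <= x <= Rad -> 0 < g x)
  (HA : 0 < A) (HAB : A < B) (Hp : 0 < p) (Hq : 0 < q).

Definition flux_weight (r : R) : R := r ^ (N - 1) * g r.
Definition ball_mass : R := Rad ^ N / INR N.
(** The boundary datum - eps^2 U'(R), free of eps; it is positive because A < B. *)
Definition wall_slope : R := Rad * (B - A) / (INR N * g Rad).
Definition reaction (V : R) : R := exp (q * V) - exp (- p * V).

(* Since [V] is the depth of the solution below the constant solution [c],
   the right-hand side of the equation is [- K * reaction V]. *)
Record layer (eps c K : R) (V dV : R -> R) : Prop := {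
  layer_eps : 0 < eps;
  layer_K : 0 < K;
  layer_cont : forall x, continuous V x;
  layer_dcont : forall x, continuous dV x;
  layer_derive : forall x, 0 < x < Rad -> is_derive V x (dV x);
  layer_flux : forall x, 0 < x < Rad ->
    is_derive (fun r => flux_weight r * dV r) x
      (x ^ (N - 1) * K / eps ^ 2 * reaction (V x));
  layer_nonneg : forall x, 0 < x <= Rad -> 0 <= V x;
  layer_incr : forall x, 0 < x <= Rad -> 0 <= dV x;
  layer_wall : dV Rad = wall_slope / eps ^ 2;
  layer_mean : RInt (fun s => s ^ (N - 1) * V s) 0 Rad = c * ball_mass;
  layer_cations : K * RInt (fun s => s ^ (N - 1) * exp (- p * V s)) 0 Rad = A * ball_mass;
  layer_anions : K * RInt (fun s => s ^ (N - 1) * exp (q * V s)) 0 Rad = B * ball_mass }.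

Lemma INR_N_pos : 0 < INR N.
Proof. apply lt_0_INR; lia. Qed.

Lemma ball_mass_pos : 0 < ball_mass.
Proof. apply Rdiv_lt_0_compat; [now apply pow_lt|exact INR_N_pos]. Qed.

Lemma g_wall_pos : 0 < g Rad.
Proof. apply Hgpos; lra. Qed.

Lemma wall_slope_pos : 0 < wall_slope.
Proof.
generalize g_wall_pos INR_N_pos; intros.
apply Rdiv_lt_0_compat; apply Rmult_lt_0_compat; lra.
Qed.

Lemma g_continuous (x : R) : continuous g x.
Proof. apply (ex_derive_continuous g x), (Hg 1%nat x). Qed.

Lemma pow_continuous (n : nat) (x : R) : continuous (fun s => s ^ n) x.
Proof. apply (ex_derive_continuous (fun s => s ^ n) x); auto_derive; exact I. Qed.

Lemma flux_weight_continuous (x : R) : continuous flux_weight x.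
Proof.
apply (continuous_mult (fun s => s ^ (N - 1)) g); [apply pow_continuous|apply g_continuous].
Qed.

Lemma flux_weight_pos (x : R) : 0 < x <= Rad -> 0 < flux_weight x.
Proof.
intros H; apply Rmult_lt_0_compat; [apply pow_lt|apply Hgpos]; lra.
Qed.

Lemma exp_comp_continuous (k : R) (f : R -> R) (x : R) :
  continuous f x -> continuous (fun s => exp (k * f s)) x.
Proof.
intros H; apply (continuous_comp (fun s => k * f s) exp).
- apply (continuous_scal_r k f), H.
- apply (ex_derive_continuous exp); auto_derive; exact I.
Qed.

Lemma weighted_continuous (f : R -> R) (x : R) :
  continuous f x -> continuous (fun s => s ^ (N - 1) * f s) x.
Proof.
intros H; apply (continuous_mult (fun s => s ^ (N - 1)) f); [apply pow_continuous|exact H].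
Qed.

Lemma weighted_ex_RInt (f : R -> R) (a b : R) :
  (forall x, continuous f x) -> ex_RInt (fun s => s ^ (N - 1) * f s) a b.
Proof.
intros H; apply (@ex_RInt_continuous R_CompleteNormedModule); intros; now apply weighted_continuous.
Qed.

Lemma RInt_weight : RInt (fun s => s ^ (N - 1)) 0 Rad = ball_mass.
Proof.
apply is_RInt_unique.
replace ball_mass with (minus ((fun x => x ^ N / INR N) Rad) ((fun x => x ^ N / INR N) 0)).
- apply (is_RInt_derive (fun x => x ^ N / INR N)).
  + intros x _; generalize INR_N_pos; intros.
    auto_derive; [exact I|].
    replace (pred N) with (N - 1)%nat by lia; field; lra.
  + intros; apply pow_continuous.
- unfold minus, plus, opp; simpl; unfold ball_mass.
  rewrite pow_i by lia; unfold Rdiv; ring.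
Qed.

Lemma RInt_weighted_pos (f : R -> R) :
  (forall x, continuous f x) -> (forall x, 0 < f x) ->
  0 < RInt (fun s => s ^ (N - 1) * f s) 0 Rad.
Proof.
intros Hc Hf; apply RInt_gt_0; [exact HR| |].
- intros x Hx; apply Rmult_lt_0_compat; [apply pow_lt; lra|apply Hf].
- intros x _; now apply weighted_continuous.
Qed.

Lemma reaction_0 : reaction 0 = 0.
Proof. unfold reaction; rewrite !Rmult_0_r; ring. Qed.

Lemma reaction_pos (y : R) : 0 < y -> 0 < reaction y.
Proof.
intros H; unfold reaction; apply Rlt_0_minus, exp_increasing; nra.
Qed.

Lemma reaction_neg (y : R) : y < 0 -> reaction y < 0.
Proof.
intros H; unfold reaction; apply Rlt_minus, exp_increasing; nra.
Qed.

(** * From a solution of the problem to a layer *)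

Section Reduction.

Variables (eps : R) (u : R -> R).
Hypotheses (Heps : 0 < eps) (Hu : solves_Nstar N Rad g A B p q eps u).

Definition cation_coeff : R := Rad ^ N / INR N * (A / Ip N Rad p u).
Definition anion_coeff : R := Rad ^ N / INR N * (B / Iq N Rad q u).
(** The level at which the two ionic terms balance: the solution c of [cation_coeff * exp (p * c) =
    anion_coeff * exp (- q * c)]. The common value is [equil_density]. Both depend on [u] through
    its integrals. *)
Definition equil_level : R := ln (anion_coeff / cation_coeff) / (p + q).
Definition equil_density : R := cation_coeff * exp (p * equil_level).

Lemma solution_continuous_on : continuous_on (fun x => 0 <= x <= Rad) u.
Proof.
destruct Hu as (du & H1 & H2 & H3 & _).
intros x [[Hx0|<-] [HxR|HxR]].
- apply (filterlim_filter_le_1 (F := locally x)); [apply filter_le_within|].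
  apply (ex_derive_continuous u); exists (du x); apply H1; lra.
- subst x; apply continuous_within_of_quotient with (du Rad).
  apply (fun h => filterlim_filter_le_1 _ h H3).
  intros P HP; unfold at_left, within in *; revert HP.
  apply (filter_imp (F := locally 0)); intros h Hh [Hn Hd]; apply Hh; destruct (Rdichotomy _ _ Hn); lra.
- apply continuous_within_of_quotient with (du 0).
  apply (fun h => filterlim_filter_le_1 _ h H2).
  intros P HP; unfold at_right, within in *; revert HP.
  apply (filter_imp (F := locally 0)); intros h Hh [Hn Hd]; apply Hh; destruct (Rdichotomy _ _ Hn); lra.
- lra.
Qed.

Let u1 (x : R) : R := u (clamp 0 Rad x).

Lemma clamped_continuous (x : R) : continuous u1 x.
Proof.
apply continuous_on_clamp; [lra|exact solution_continuous_on].
Qed.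

Lemma clamped_RInt (f : R -> R) :
  RInt (fun s => s ^ (N - 1) * f (u s)) 0 Rad =
  RInt (fun s => s ^ (N - 1) * f (u1 s)) 0 Rad.
Proof.
apply RInt_ext; rewrite Rmin_left, Rmax_right by lra.
intros x Hx; unfold u1; rewrite clamp_id by lra; reflexivity.
Qed.

Lemma Ip_pos : 0 < Ip N Rad p u.
Proof.
unfold Ip; rewrite (clamped_RInt (fun y => exp (p * y))).
apply (RInt_weighted_pos (fun s => exp (p * u1 s))); [|intros; apply exp_pos].
intros; apply exp_comp_continuous, clamped_continuous.
Qed.

Lemma Iq_pos : 0 < Iq N Rad q u.
Proof.
unfold Iq; rewrite (clamped_RInt (fun y => exp (- q * y))).
apply (RInt_weighted_pos (fun s => exp (- q * u1 s))); [|intros; apply exp_pos].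
intros; apply exp_comp_continuous, clamped_continuous.
Qed.

Lemma cation_coeff_pos : 0 < cation_coeff.
Proof.
apply Rmult_lt_0_compat; [exact ball_mass_pos|].
apply Rdiv_lt_0_compat; [exact HA|exact Ip_pos].
Qed.

Lemma anion_coeff_pos : 0 < anion_coeff.
Proof.
apply Rmult_lt_0_compat; [exact ball_mass_pos|].
apply Rdiv_lt_0_compat; [lra|exact Iq_pos].
Qed.

Lemma equil_density_anion : equil_density = anion_coeff * exp (- q * equil_level).
Proof.
generalize cation_coeff_pos anion_coeff_pos; intros Hc Ha.
assert (E : exp ((p + q) * equil_level) = anion_coeff / cation_coeff).
{ unfold equil_level.
  replace ((p + q) * (ln (anion_coeff / cation_coeff) / (p + q)))
    with (ln (anion_coeff / cation_coeff)) by (field; lra).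
  apply exp_ln, Rdiv_lt_0_compat; assumption. }
unfold equil_density.
replace (p * equil_level) with ((p + q) * equil_level + - q * equil_level) by ring.
rewrite exp_plus, E; field; lra.
Qed.

Lemma Nrhs_reaction (r : R) :
  Nrhs N Rad A B p q u r = - equil_density * reaction (equil_level - u r).
Proof.
unfold reaction.
replace (- equil_density * (exp (q * (equil_level - u r)) - exp (- p * (equil_level - u r))))
  with (equil_density * exp (- p * (equil_level - u r))
        - equil_density * exp (q * (equil_level - u r))) by ring.
rewrite equil_density_anion at 2; unfold equil_density.
rewrite !Rmult_assoc, <- !exp_plus.
replace (p * equil_level + - p * (equil_level - u r)) with (p * u r) by ring.
replace (- q * equil_level + q * (equil_level - u r)) with (- q * u r) by ring.
unfold Nrhs, cation_coeff, anion_coeff, Rdiv; ring.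
Qed.

Definition depth (x : R) : R := equil_level - u (clamp 0 Rad x).

(** All later arguments use the boundary value problem only through this lemma and the definition of
    [depth]. The three integral fields of [layer] restate the mean condition and the definitions of
    the two coefficients. *)
Lemma solution_layer :
  exists dV : R -> R, layer eps equil_level equil_density depth dV /\
  forall r, 0 < r < Rad ->
    u r = equil_level - depth r /\ Derive u r = - dV r /\
    rho N Rad A B p q u r = equil_density * reaction (depth r).
Proof.
generalize solution_continuous_on clamped_continuous Nrhs_reaction clamped_RInt.
intros Hucont Hu1c Hrhs Hint.
destruct Hu as (du & H1 & _ & _ & H4 & H5 & H6 & H7 & H8 & H9).
set (c := equil_level) in *; set (K := equil_density) in *.
assert (HK : 0 < K).
{ apply Rmult_lt_0_compat; [exact cation_coeff_pos|apply exp_pos]. }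
exists (fun x => - du (clamp 0 Rad x)); unfold depth; fold c.
change (fun x => c - u (clamp 0 Rad x)) with (fun x => c - u1 x).
assert (Hloc : forall x, 0 < x < Rad -> locally x (fun y => 0 < y < Rad)).
{ intros x Hx; apply (open_and (fun y => 0 < y) (fun y => y < Rad));
    [apply open_gt|apply open_lt|exact Hx]. }
assert (Cdu : forall x, continuous (fun x => - du (clamp 0 Rad x)) x).
{ intros x; apply (continuous_opp (fun y => du (clamp 0 Rad y))).
  apply continuous_on_clamp; [lra|exact H4]. }
assert (CV : forall x, continuous (fun x => c - u1 x) x).
{ intros x; apply (continuous_minus (fun _ => c) u1); [apply continuous_const|apply Hu1c]. }
assert (DV : forall x, 0 < x < Rad ->
  is_derive (fun x => c - u1 x) x (- du (clamp 0 Rad x))).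
{ intros x Hx; rewrite clamp_id by lra.
  apply (is_derive_ext_loc (fun y => c - u y)).
  - generalize (Hloc x Hx); apply filter_imp; intros y Hy.
    unfold u1; rewrite clamp_id by lra; reflexivity.
  - replace (- du x) with (minus 0 (du x)) by (unfold minus, plus, opp; simpl; ring).
    apply (is_derive_minus (fun _ => c) u); [apply (@is_derive_const R_AbsRing R_NormedModule)|now apply H1]. }
(* Divergence form: multiplying the equation by x^(N-1) collects U'' and the first-order terms into
   the derivative of [flux_weight * U']. One factor x is split off x^(N-1) to cancel the 1/x. *)
assert (Dw : forall x, 0 < x < Rad ->
  is_derive (fun r => flux_weight r * - du (clamp 0 Rad r)) x
    (x ^ (N - 1) * K / eps ^ 2 * reaction (c - u1 x))).
{ intros x Hx.
  apply (is_derive_ext_loc (fun r => - (flux_weight r * Derive u r))).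
  { generalize (Hloc x Hx); apply filter_imp; intros y Hy.
    rewrite clamp_id by lra; rewrite (is_derive_unique u y (du y)) by now apply H1.
    apply eq_sym, Ropp_mult_distr_r_reverse. }
  assert (Dg : is_derive g x (Derive g x)) by apply Derive_correct, (Hg 1%nat x).
  assert (Du : is_derive (Derive u) x (Derive_n u 2 x)).
  { apply Derive_correct, (H5 2%nat x Hx). }
  specialize (H6 x Hx); rewrite Hrhs in H6; fold c K in H6.
  assert (gx : 0 < g x) by (apply Hgpos; lra).
  unfold u1; rewrite clamp_id by lra.
  assert (Ex : x ^ (N - 1) = x * x ^ (N - 2)).
  { replace (N - 1)%nat with (S (N - 2)) by lia; reflexivity. }
  assert (Dx : is_derive (fun r => r ^ (N - 1)) x ((INR N - 1) * x ^ (N - 2))).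
  { auto_derive; [exact I|].
    replace (Nat.pred (N - 1)) with (N - 2)%nat by lia.
    rewrite minus_INR by lia; simpl (INR 1); ring. }
  set (d2 := Derive_n u 2 x) in *; set (d1 := Derive u x) in *.
  replace (x ^ (N - 1) * K / eps ^ 2 * reaction (c - u x)) with
    (- ((((INR N - 1) * x ^ (N - 2)) * g x + x ^ (N - 1) * Derive g x) * d1
        + flux_weight x * d2)).
  { apply (is_derive_opp (fun r => flux_weight r * Derive u r)).
    apply (is_derive_mult flux_weight (Derive u)); [|exact Du|intros; apply Rmult_comm].
    apply (is_derive_mult (fun r => r ^ (N - 1)) g); [exact Dx|exact Dg|intros; apply Rmult_comm]. }
  apply (Rmult_eq_reg_l (eps ^ 2)); [|apply pow_nonzero; lra].
  transitivity (x ^ (N - 1) * (K * reaction (c - u x))); [|field; lra].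
  replace (K * reaction (c - u x)) with
    (- (eps ^ 2 * g x * (d2 + ((INR N - 1) / x + Derive g x / g x) * d1)))
    by (rewrite H6; ring).
  unfold flux_weight; rewrite Ex; field; lra. }
assert (HN0 := INR_N_pos).
assert (Wall : - du (clamp 0 Rad Rad) = wall_slope / eps ^ 2).
{ rewrite clamp_id by lra; rewrite H9; unfold wall_slope.
  generalize g_wall_pos; intros; field; repeat split; try lra. }
assert (Sign : forall x, 0 < x <= Rad -> 0 <= c - u1 x /\ 0 <= - du (clamp 0 Rad x)).
{ apply (flux_and_profile_nonneg Rad (fun x => c - u1 x) (fun x => - du (clamp 0 Rad x))
    flux_weight (fun x => x ^ (N - 1) * K / eps ^ 2) reaction);
    try assumption.
  - exact flux_weight_continuous.
  - exact flux_weight_pos.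
  - intros x Hx; apply Rdiv_lt_0_compat; [|apply pow_lt; lra].
    apply Rmult_lt_0_compat; [apply pow_lt; lra|exact HK].
  - exact reaction_0.
  - exact reaction_pos.
  - exact reaction_neg.
  - rewrite clamp_id by lra; rewrite H8; ring.
  - rewrite Wall; apply Rdiv_lt_0_compat; [exact wall_slope_pos|apply pow_lt; lra]. }
split.
- constructor; try assumption.
  + intros x Hx; now apply Sign.
  + intros x Hx; now apply Sign.
  (* U has weighted mean zero, so only the constant c contributes. *)
  + transitivity (RInt (fun s => minus (scal c (s ^ (N - 1))) (s ^ (N - 1) * u1 s)) 0 Rad).
    { apply RInt_ext; intros x _; unfold minus, plus, opp, scal; simpl; unfold mult; simpl.
      change (x ^ (N - 1) * (c - u1 x) = c * x ^ (N - 1) + - (x ^ (N - 1) * u1 x)); ring. }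
    rewrite (RInt_minus (V := R_CompleteNormedModule)).
    * rewrite (RInt_scal (V := R_CompleteNormedModule)).
      -- rewrite RInt_weight, <- (Hint (fun y => y)), H7.
         unfold minus, plus, opp, scal; simpl; unfold mult; simpl; ring.
      -- apply (@ex_RInt_continuous R_CompleteNormedModule); intros; apply pow_continuous.
    * apply (@ex_RInt_scal R_NormedModule).
      apply (@ex_RInt_continuous R_CompleteNormedModule); intros; apply pow_continuous.
    * now apply weighted_ex_RInt.
  (* The factor exp (- p c) pulled out of the integral cancels the exp (p c) in K, and the integral
     [Ip] cancels the one in [cation_coeff]. The anion identity is the same with K written through
     [anion_coeff]. *)
  + transitivity (K * RInt (fun s => scal (exp (- p * c)) (s ^ (N - 1) * exp (p * u1 s))) 0 Rad).
    { apply f_equal, RInt_ext; intros x _; unfold scal; simpl; unfold mult; simpl.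
      replace (- p * (c - u1 x)) with (- p * c + p * u1 x) by ring.
      rewrite exp_plus; ring. }
    rewrite (RInt_scal (V := R_CompleteNormedModule)) by (apply weighted_ex_RInt; intros; now apply exp_comp_continuous).
    rewrite <- (Hint (fun y => exp (p * y))); fold (Ip N Rad p u).
    generalize Ip_pos; intros; unfold scal; simpl; unfold mult; simpl.
    unfold K, equil_density, cation_coeff; fold c.
    replace (- p * c) with (- (p * c)) by ring; rewrite exp_Ropp.
    unfold ball_mass; field; repeat split; try lra.
    apply Rgt_not_eq, exp_pos.
  + transitivity (K * RInt (fun s => scal (exp (q * c)) (s ^ (N - 1) * exp (- q * u1 s))) 0 Rad).
    { apply f_equal, RInt_ext; intros x _; unfold scal; simpl; unfold mult; simpl.
      replace (q * (c - u1 x)) with (q * c + - q * u1 x) by ring.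
      rewrite exp_plus; ring. }
    rewrite (RInt_scal (V := R_CompleteNormedModule)) by (apply weighted_ex_RInt; intros; now apply exp_comp_continuous).
    rewrite <- (Hint (fun y => exp (- q * y))); fold (Iq N Rad q u).
    generalize Iq_pos; intros; unfold scal; simpl; unfold mult; simpl.
    unfold K; rewrite equil_density_anion; unfold anion_coeff; fold c.
    replace (- q * c) with (- (q * c)) by ring; rewrite exp_Ropp.
    unfold ball_mass; field; repeat split; try lra.
    apply Rgt_not_eq, exp_pos.
- intros r Hr; rewrite clamp_id by lra; repeat split.
  + ring.
  + rewrite (is_derive_unique u r (du r)) by now apply H1. ring.
  + unfold rho; rewrite Hrhs; ring.
Qed.

End Reduction.

(** * Bounds for a single layer *)

Section Estimates.

Variables (eps c K : R) (V dV : R -> R).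
Hypothesis L : layer eps c K V dV.

Let flux (r : R) : R := flux_weight r * dV r.

Lemma flux_continuous (x : R) : continuous flux x.
Proof.
apply (continuous_mult flux_weight dV); [apply flux_weight_continuous|apply L].
Qed.

Lemma profile_mono (x y : R) : 0 <= x -> x <= y -> y <= Rad -> V x <= V y.
Proof.
intros Hx Hxy Hy; apply (nondecreasing_of_derive V dV); [exact Hxy| | |].
- intros; apply L.
- intros z Hz; apply (layer_derive _ _ _ _ _ L); lra.
- intros z Hz; apply (layer_incr _ _ _ _ _ L); lra.
Qed.

Lemma reaction_ge (y : R) : 0 <= y -> q * y <= reaction y.
Proof.
intros Hy; unfold reaction.
assert (1 + q * y <= exp (q * y)) by apply exp_ineq1_le.
assert (exp (- p * y) <= 1).
{ rewrite <- exp_0; apply exp_nondecreasing; nra. }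
lra.
Qed.

Lemma reaction_mono (x y : R) : x <= y -> reaction x <= reaction y.
Proof.
intros H; unfold reaction.
assert (exp (q * x) <= exp (q * y)) by (apply exp_nondecreasing; nra).
assert (exp (- p * y) <= exp (- p * x)) by (apply exp_nondecreasing; nra).
lra.
Qed.

Lemma layer_reaction_nonneg (x : R) : 0 < x <= Rad -> 0 <= reaction (V x).
Proof.
intros Hx; assert (H := layer_nonneg _ _ _ _ _ L x Hx).
apply Rle_trans with (2 := reaction_ge _ H); nra.
Qed.

Lemma flux_derive_nonneg (x : R) : 0 < x < Rad ->
  0 <= x ^ (N - 1) * K / eps ^ 2 * reaction (V x).
Proof.
intros Hx; assert (HK := layer_K _ _ _ _ _ L); assert (He := layer_eps _ _ _ _ _ L).
apply Rmult_le_pos; [|apply layer_reaction_nonneg; lra].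
apply Rlt_le, Rdiv_lt_0_compat; [apply Rmult_lt_0_compat; [apply pow_lt|]; lra|apply pow_lt, He].
Qed.

Lemma flux_mono (x y : R) : 0 <= x -> x <= y -> y <= Rad -> flux x <= flux y.
Proof.
intros Hx Hxy Hy; apply (nondecreasing_of_derive flux
  (fun r => r ^ (N - 1) * K / eps ^ 2 * reaction (V r))); [exact Hxy| | |].
- intros; apply flux_continuous.
- intros z Hz; apply (layer_flux _ _ _ _ _ L); lra.
- intros z Hz; apply flux_derive_nonneg; lra.
Qed.

Lemma flux_nonneg (x : R) : 0 < x <= Rad -> 0 <= flux x.
Proof.
intros Hx; apply Rmult_le_pos; [now apply Rlt_le, flux_weight_pos|now apply L].
Qed.

Lemma RInt_weighted_le (f h : R -> R) :
  (forall x, continuous f x) -> (forall x, continuous h x) ->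
  (forall x, 0 < x < Rad -> f x <= h x) ->
  RInt (fun s => s ^ (N - 1) * f s) 0 Rad <= RInt (fun s => s ^ (N - 1) * h s) 0 Rad.
Proof.
intros Hf Hh Hfh; apply RInt_le; [lra|now apply weighted_ex_RInt|now apply weighted_ex_RInt|].
intros x Hx; apply Rmult_le_compat_l; [apply pow_le; lra|now apply Hfh].
Qed.

Lemma RInt_weighted_const (k : R) : RInt (fun s => s ^ (N - 1) * k) 0 Rad = k * ball_mass.
Proof.
transitivity (RInt (fun s => scal k (s ^ (N - 1))) 0 Rad).
{ apply RInt_ext; intros; unfold scal; simpl; unfold mult; simpl; apply Rmult_comm. }
rewrite (RInt_scal (V := R_CompleteNormedModule)).
- rewrite RInt_weight; reflexivity.
- apply (@ex_RInt_continuous R_CompleteNormedModule); intros; apply pow_continuous.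
Qed.

(** V >= 0 gives exp (- p V) <= 1 in the cation integral. *)
Lemma equil_density_ge : A <= K.
Proof.
generalize ball_mass_pos (layer_K _ _ _ _ _ L) (layer_cations _ _ _ _ _ L); intros Hm HK E.
assert (RInt (fun s => s ^ (N - 1) * exp (- p * V s)) 0 Rad <= 1 * ball_mass).
{ rewrite <- RInt_weighted_const; apply (RInt_weighted_le (fun s => exp (- p * V s)) (fun _ => 1)).
  - intros; apply exp_comp_continuous, L.
  - intros; apply continuous_const.
  - intros x Hx; rewrite <- exp_0; apply exp_nondecreasing.
    assert (0 <= V x) by (apply L; lra); nra. }
apply Rmult_le_reg_r with ball_mass; [exact Hm|]; nra.
Qed.

Lemma equil_level_nonneg : 0 <= c.
Proof.
generalize ball_mass_pos (layer_mean _ _ _ _ _ L); intros Hm E.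
assert (0 * ball_mass <= RInt (fun s => s ^ (N - 1) * V s) 0 Rad).
{ rewrite <- RInt_weighted_const; apply (RInt_weighted_le (fun _ => 0) V).
  - intros; apply continuous_const.
  - apply L.
  - intros x Hx; apply L; lra. }
apply Rmult_le_reg_r with ball_mass; [exact Hm|]; lra.
Qed.

(** Integrating exp (- p V) >= 1 - p V brings in the mean of V, which is c. A small c therefore
    forces K down to A. *)
Lemma equil_density_le : K * (1 - p * c) <= A.
Proof.
generalize ball_mass_pos (layer_K _ _ _ _ _ L) (layer_cations _ _ _ _ _ L)
  (layer_mean _ _ _ _ _ L); intros Hm HK E E'.
assert (H : RInt (fun s => s ^ (N - 1) * (1 - p * V s)) 0 Rad <=
        RInt (fun s => s ^ (N - 1) * exp (- p * V s)) 0 Rad).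
{ apply (RInt_weighted_le (fun s => 1 - p * V s) (fun s => exp (- p * V s))).
  - intros x; apply (continuous_minus (fun _ => 1) (fun s => p * V s)).
    + apply continuous_const.
    + apply (continuous_scal_r p V), L.
  - intros; apply exp_comp_continuous, L.
  - intros x Hx; generalize (exp_ineq1_le (- p * V x)); lra. }
assert (H' : RInt (fun s => s ^ (N - 1) * (1 - p * V s)) 0 Rad = (1 - p * c) * ball_mass).
{ transitivity (RInt (fun s => minus (s ^ (N - 1)) (scal p (s ^ (N - 1) * V s))) 0 Rad).
  { apply RInt_ext; intros x _; unfold minus, plus, opp, scal; simpl; unfold mult; simpl.
    change (x ^ (N - 1) * (1 - p * V x) = x ^ (N - 1) + - (p * (x ^ (N - 1) * V x))); ring. }
  assert (X : ex_RInt (fun s => s ^ (N - 1) * V s) 0 Rad) by (apply weighted_ex_RInt, L).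
  rewrite (RInt_minus (V := R_CompleteNormedModule)).
  - rewrite (RInt_scal (V := R_CompleteNormedModule)) by exact X.
    rewrite RInt_weight, E'.
    unfold minus, plus, opp, scal; simpl; unfold mult; simpl; ring.
  - apply (@ex_RInt_continuous R_CompleteNormedModule); intros; apply pow_continuous.
  - now apply (@ex_RInt_scal R_NormedModule). }
apply Rmult_le_reg_r with ball_mass; [exact Hm|]; nra.
Qed.

(** The total flux at the wall is [flux_weight Rad * wall_slope / eps ^ 2], and between x and the
    wall it grows at rate at least a constant times V x / eps^2, as V is increasing. The powers of
    eps cancel, leaving V x = O(1 / (R - x)) uniformly in eps. *)
Lemma profile_tail_bound (x : R) : Rad / 2 <= x <= Rad ->
  V x * (Rad - x) * ((Rad / 2) ^ (N - 1) * (A * q)) <= flux_weight Rad * wall_slope.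
Proof.
intros [Hx1 [Hx2| ->]].
2:{ rewrite Rminus_diag, Rmult_0_r, Rmult_0_l; apply Rlt_le, Rmult_lt_0_compat;
    [apply flux_weight_pos; lra|exact wall_slope_pos]. }
assert (He := layer_eps _ _ _ _ _ L); assert (HK := equil_density_ge).
destruct (MVT_open flux (fun r => r ^ (N - 1) * K / eps ^ 2 * reaction (V r)) x Rad Hx2)
  as (z & Hz & Ez).
{ intros; apply flux_continuous. }
{ intros y Hy; apply (layer_flux _ _ _ _ _ L); lra. }
assert (E : flux Rad = flux_weight Rad * wall_slope / eps ^ 2).
{ unfold flux; rewrite (layer_wall _ _ _ _ _ L); field; lra. }
assert (H0 : 0 <= flux x) by (apply flux_nonneg; lra).
assert (Vx : 0 <= V x) by (apply L; lra).
assert (H1 : A * q * V x <= K * reaction (V z)).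
{ assert (q * V x <= reaction (V z)).
  { apply Rle_trans with (1 := reaction_ge _ Vx).
    apply reaction_mono, profile_mono; lra. }
  assert (0 <= q * V x) by (apply Rmult_le_pos; lra).
  rewrite Rmult_assoc; apply Rmult_le_compat; lra. }
assert (H2 : (Rad / 2) ^ (N - 1) <= z ^ (N - 1)) by (apply pow_incr; lra).
assert (H3 : 0 < (Rad / 2) ^ (N - 1)) by (apply pow_lt; lra).
assert (H4 : (Rad / 2) ^ (N - 1) * (A * q * V x) <= z ^ (N - 1) * (K * reaction (V z))).
{ apply Rmult_le_compat; try lra.
  apply Rmult_le_pos; nra. }
assert (H5 : z ^ (N - 1) * (K * reaction (V z)) * (Rad - x) <= flux_weight Rad * wall_slope).
{ assert (0 < eps ^ 2) by now apply pow_lt.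
  apply Rmult_le_reg_r with (/ eps ^ 2); [now apply Rinv_0_lt_compat|].
  unfold Rdiv in *; nra. }
nra.
Qed.

(** The sum E = V + eps w satisfies E' >= (l / eps) E: the part V' is at least l w, and eps w' is at
    least l V / eps. The two bounds on l are exactly what these inequalities require, and the factor
    eps gives both parts the same rate. *)
Lemma profile_decay (l x y : R) :
  0 < l -> l <= (Rad / 2) ^ (N - 1) * (A * q) ->
  (forall r, 0 <= r <= Rad -> flux_weight r * l <= 1) ->
  Rad / 2 <= x -> x <= y -> y <= Rad ->
  V x + eps * flux x <= (V y + eps * flux y) * exp (- l * (y - x) / eps).
Proof.
intros Hl Hl1 Hl2 Hx Hxy Hy.
assert (He := layer_eps _ _ _ _ _ L); assert (HK := equil_density_ge).
set (E := fun r => V r + eps * flux r).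
set (dE := fun r => dV r + eps * (r ^ (N - 1) * K / eps ^ 2 * reaction (V r))).
assert (CE : forall r, continuous E r).
{ intros r; apply (continuous_plus V (fun s => eps * flux s)); [apply L|].
  apply (continuous_scal_r eps flux), flux_continuous. }
assert (DE : forall r, 0 < r < Rad -> is_derive E r (dE r)).
{ intros r Hr; apply (is_derive_plus V (fun s => eps * flux s)); [now apply L|].
  apply (is_derive_scal flux); now apply L. }
assert (Hgrow : forall r, Rad / 2 <= r < Rad -> l / eps * E r <= dE r).
{ intros r Hr; unfold E, dE.
  assert (0 <= V r) by (apply L; lra).
  assert (0 <= dV r) by (apply L; lra).
  assert (l * flux r <= dV r).
  { unfold flux; assert (flux_weight r * l <= 1) by (apply Hl2; lra). nra. }
  assert (l * V r <= r ^ (N - 1) * K * reaction (V r)).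
  { assert ((Rad / 2) ^ (N - 1) <= r ^ (N - 1)) by (apply pow_incr; lra).
    assert (0 < (Rad / 2) ^ (N - 1)) by (apply pow_lt; lra).
    assert (q * V r <= reaction (V r)) by now apply reaction_ge.
    assert (0 <= q * V r) by (apply Rmult_le_pos; lra).
    assert (A * (q * V r) <= K * reaction (V r)) by (apply Rmult_le_compat; lra).
    assert ((Rad / 2) ^ (N - 1) * (A * (q * V r)) <= r ^ (N - 1) * (K * reaction (V r)))
      by (apply Rmult_le_compat; try lra; apply Rmult_le_pos; lra).
    nra. }
  replace (l / eps * (V r + eps * flux r)) with (/ eps * (l * V r) + l * flux r)
    by (field; lra).
  replace (eps * (r ^ (N - 1) * K / eps ^ 2 * reaction (V r)))
    with (/ eps * (r ^ (N - 1) * K * reaction (V r))) by (field; lra).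
  assert (0 < / eps) by now apply Rinv_0_lt_compat.
  nra. }
(* Integrating factor: E exp (- l r / eps) is nondecreasing by [Hgrow]. *)
assert (H : E x * exp (- l / eps * x) <= E y * exp (- l / eps * y)).
{ apply (nondecreasing_of_derive (fun r => E r * exp (- l / eps * r))
    (fun r => dE r * exp (- l / eps * r) + E r * (- l / eps * exp (- l / eps * r))));
    [exact Hxy| | |].
  - intros r _; apply (continuous_mult E (fun r => exp (- l / eps * r))); [apply CE|].
    apply (exp_comp_continuous (- l / eps) (fun r => r)), continuous_id.
  - intros r Hr; apply (is_derive_mult E (fun r => exp (- l / eps * r)));
      [apply DE; lra| |intros; apply Rmult_comm].
    auto_derive; [exact I|ring].
  - intros r Hr; assert (l / eps * E r <= dE r) by (apply Hgrow; lra).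
    assert (0 < exp (- l / eps * r)) by apply exp_pos.
    replace (- l / eps) with (- (l / eps)) in * by (unfold Rdiv; ring).
    nra. }
apply Rmult_le_reg_r with (exp (- l / eps * x)); [apply exp_pos|].
apply Rle_trans with (1 := H); right; fold (E y).
rewrite Rmult_assoc, <- exp_plus; do 2 f_equal; field; lra.
Qed.

End Estimates.

Lemma flux_weight_bound : exists M, 0 < M /\ forall r, 0 <= r <= Rad -> flux_weight r <= M.
Proof.
destruct (continuity_ab_maj flux_weight 0 Rad) as (x & Hx & _); [lra| |].
{ intros; apply continuity_pt_filterlim, flux_weight_continuous. }
exists (Rabs (flux_weight x) + 1); split; [generalize (Rabs_pos (flux_weight x)); lra|].
intros r Hr; apply Rle_trans with (1 := Hx r Hr); generalize (Rle_abs (flux_weight x)); lra.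
Qed.

(** V at the wall is not controlled, so the decay is started at R - x/2, where [profile_tail_bound]
    gives V = O(1/x) and monotonicity bounds w by its wall value O(1 / eps^2). Covering only half
    the distance halves the rate, whence the witness l / 2. *)
Lemma layer_decay : exists C l, 0 < C /\ 0 < l /\
  forall eps c K V dV, layer eps c K V dV ->
  forall x, 0 < x <= Rad / 2 ->
  V (Rad - x) + eps * (flux_weight (Rad - x) * dV (Rad - x))
  <= C * (/ x + / eps) * exp (- l * x / eps).
Proof.
destruct flux_weight_bound as (M & HM & HMb).
set (a0 := (Rad / 2) ^ (N - 1) * (A * q)).
assert (Ha0 : 0 < a0) by (apply Rmult_lt_0_compat; [apply pow_lt; lra|nra]).
assert (HW : 0 < flux_weight Rad * wall_slope)
  by (apply Rmult_lt_0_compat; [apply flux_weight_pos; lra|exact wall_slope_pos]).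
set (W := flux_weight Rad * wall_slope) in *.
set (l := Rmin a0 (/ M)).
assert (Hl : 0 < l) by (apply Rmin_pos; [exact Ha0|now apply Rinv_0_lt_compat]).
assert (HC : 0 < 2 * W / a0) by (apply Rdiv_lt_0_compat; lra).
exists (2 * W / a0 + W), (l / 2); split; [lra|split; [lra|]].
intros eps c K V dV L x Hx.
assert (He := layer_eps _ _ _ _ _ L).
assert (H := profile_decay _ _ _ _ _ L l (Rad - x) (Rad - x / 2) Hl (Rmin_l _ _)).
assert (HlM : forall r, 0 <= r <= Rad -> flux_weight r * l <= 1).
{ intros r Hr; apply Rle_trans with (M * l).
  - apply Rmult_le_compat_r; [lra|now apply HMb].
  - apply Rle_trans with (M * / M); [|right; field; lra].
    apply Rmult_le_compat_l; [lra|apply Rmin_r]. }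
apply Rle_trans with (1 := H HlM ltac:(lra) ltac:(lra) ltac:(lra)).
replace (- l * (Rad - x / 2 - (Rad - x)) / eps) with (- (l / 2) * x / eps) by (field; lra).
apply Rmult_le_compat_r; [apply Rlt_le, exp_pos|].
assert (HV : V (Rad - x / 2) <= 2 * W / a0 * / x).
{ assert (T := profile_tail_bound _ _ _ _ _ L (Rad - x / 2) ltac:(lra)).
  fold a0 W in T.
  apply Rmult_le_reg_r with (x / 2 * a0); [apply Rmult_lt_0_compat; lra|].
  replace (2 * W / a0 * / x * (x / 2 * a0)) with W by (field; lra).
  replace (Rad - (Rad - x / 2)) with (x / 2) in T by ring; lra. }
assert (HF : eps * (flux_weight (Rad - x / 2) * dV (Rad - x / 2)) <= W * / eps).
{ apply Rle_trans with (eps * (flux_weight Rad * dV Rad)).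
  - apply Rmult_le_compat_l; [lra|].
    apply (flux_mono _ _ _ _ _ L); lra.
  - rewrite (layer_wall _ _ _ _ _ L); unfold W; right; field; lra. }
assert (0 < / x) by (apply Rinv_0_lt_compat; lra).
assert (0 < / eps) by now apply Rinv_0_lt_compat.
nra.
Qed.

(** * Estimates uniform in the profile *)

(** The threshold is chosen before c, K and the profile, all of which vary with eps in the
    application. *)
Definition eventually_layer (P : R -> R -> R -> (R -> R) -> (R -> R) -> Prop) : Prop :=
  exists e0, 0 < e0 /\
  forall eps c K V dV, layer eps c K V dV -> eps < e0 -> P eps c K V dV.

Lemma eventually_layer_and (P Q : R -> R -> R -> (R -> R) -> (R -> R) -> Prop) :
  eventually_layer P -> eventually_layer Q ->
  eventually_layer (fun eps c K V dV => P eps c K V dV /\ Q eps c K V dV).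
Proof.
intros (e & He & H) (e' & He' & H'); exists (Rmin e e'); split; [now apply Rmin_pos|].
intros eps c K V dV L Hl; split; [apply H|apply H']; try assumption;
  apply Rlt_le_trans with (1 := Hl); [apply Rmin_l|apply Rmin_r].
Qed.

Lemma eventually_layer_mono (P Q : R -> R -> R -> (R -> R) -> (R -> R) -> Prop) :
  (forall eps c K V dV, layer eps c K V dV -> P eps c K V dV -> Q eps c K V dV) ->
  eventually_layer P -> eventually_layer Q.
Proof.
intros HPQ (e & He & H); exists e; split; [exact He|].
intros; apply HPQ; [assumption|now apply H].
Qed.

Lemma eventually_layer_small (e : R) : 0 < e ->
  eventually_layer (fun eps _ _ _ _ => eps < e).
Proof. intros He; exists e; split; [exact He|intros; assumption]. Qed.

Lemma layer_inner_small (x eta : R) : 0 < x <= Rad / 2 -> 0 < eta ->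
  eventually_layer (fun eps c K V dV =>
    V (Rad - x) <= eta /\ eps * (flux_weight (Rad - x) * dV (Rad - x)) <= eta).
Proof.
intros Hx Heta; destruct layer_decay as (C & l & HC & Hl & H).
(* From exp (- y) <= 4 / y^2 at y = l x / eps, the decay bound is at most C2 eps when eps < 1: one
   power of eps survives the term 1 / eps. *)
set (C2 := C * (/ x + 1) * (4 / (l * x) ^ 2)).
assert (Hix : 0 < / x) by (apply Rinv_0_lt_compat; lra).
assert (Hlx : 0 < l * x) by nra.
assert (HC2 : 0 < C2).
{ apply Rmult_lt_0_compat; [nra|apply Rdiv_lt_0_compat; [lra|now apply pow_lt]]. }
exists (Rmin 1 (eta / C2)); split.
{ apply Rmin_pos; [lra|now apply Rdiv_lt_0_compat]. }
intros eps c K V dV L He.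
assert (He0 := layer_eps _ _ _ _ _ L).
assert (He1 : eps < 1) by (apply Rlt_le_trans with (1 := He), Rmin_l).
assert (He2 : eps < eta / C2) by (apply Rlt_le_trans with (1 := He), Rmin_r).
assert (HE : V (Rad - x) + eps * (flux_weight (Rad - x) * dV (Rad - x)) <= eta).
{ apply Rle_trans with (1 := H _ _ _ _ _ L x Hx).
  apply Rle_trans with (C2 * eps).
  2:{ apply Rmult_le_reg_l with (/ C2); [now apply Rinv_0_lt_compat|].
      unfold Rdiv in He2; field_simplify; [|lra|lra]. lra. }
  apply Rle_trans with (C * (/ x + / eps) * (4 / (l * x) ^ 2 * eps ^ 2)).
  - apply Rmult_le_compat_l.
    { apply Rmult_le_pos; [lra|]; assert (0 < / eps) by (now apply Rinv_0_lt_compat); lra. }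
    replace (- l * x / eps) with (- (l * x / eps)) by (field; lra).
    rewrite exp_Ropp.
    set (y := l * x / eps).
    assert (Hy : 0 < y) by now apply Rdiv_lt_0_compat.
    replace (4 / (l * x) ^ 2 * eps ^ 2) with (/ (y ^ 2 / 4)) by (unfold y; field; lra).
    apply Rinv_le_contravar; [apply Rdiv_lt_0_compat; [now apply pow_lt|lra]|].
    now apply exp_ge_square, Rlt_le.
  - unfold C2.
    replace (C * (/ x + / eps) * (4 / (l * x) ^ 2 * eps ^ 2)) with
      (C * (eps / x + 1) * (4 / (l * x) ^ 2) * eps) by (field; lra).
    apply Rmult_le_compat_r; [lra|].
    apply Rmult_le_compat_r.
    { apply Rlt_le, Rdiv_lt_0_compat; [lra|now apply pow_lt]. }
    apply Rmult_le_compat_l; [lra|]; unfold Rdiv; nra. }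
assert (0 <= V (Rad - x)) by (apply L; lra).
assert (0 <= flux_weight (Rad - x) * dV (Rad - x)) by (apply (flux_nonneg _ _ _ _ _ L); lra).
split; nra.
Qed.

(** The integral of V is split at distance d from the wall. Inside, V is at most V (R - d); in the
    collar V is dominated by th times a multiple of exp (q V) plus 1 / (4 th). The parameter [th]
    trades the anion integral against the width of the collar. *)
Lemma profile_integral_le (eps c K : R) (V dV : R -> R) (d th : R) :
  layer eps c K V dV -> 0 < d <= Rad / 2 -> 0 < th ->
  c * ball_mass <= Rad ^ (N - 1) * Rad * V (Rad - d)
    + 4 * th / q ^ 2 * (B * ball_mass / A) + Rad ^ (N - 1) * d / (4 * th).
Proof.
intros L Hd Hth.
assert (HK := equil_density_ge _ _ _ _ _ L).
assert (cV := layer_cont _ _ _ _ _ L).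
set (f := fun s => s ^ (N - 1) * V s).
set (h := fun s => s ^ (N - 1) * exp (q * V s)).
assert (Xf : forall a b, ex_RInt f a b) by (intros; now apply weighted_ex_RInt).
assert (Xh : forall a b, ex_RInt h a b).
{ intros; apply (weighted_ex_RInt (fun s => exp (q * V s))); intros; now apply exp_comp_continuous. }
rewrite <- (layer_mean _ _ _ _ _ L); fold f.
rewrite <- (RInt_Chasles f 0 (Rad - d) Rad (Xf _ _) (Xf _ _)).
change (RInt f 0 (Rad - d) + RInt f (Rad - d) Rad <=
  Rad ^ (N - 1) * Rad * V (Rad - d) + 4 * th / q ^ 2 * (B * ball_mass / A)
  + Rad ^ (N - 1) * d / (4 * th)).
assert (V1 : 0 <= V (Rad - d)) by (apply L; lra).
assert (PR : 0 < Rad ^ (N - 1)) by now apply pow_lt.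
assert (I1 : RInt f 0 (Rad - d) <= Rad ^ (N - 1) * Rad * V (Rad - d)).
{ apply Rle_trans with (RInt (fun _ => Rad ^ (N - 1) * V (Rad - d)) 0 (Rad - d)).
  - apply RInt_le; [lra|apply Xf|apply (@ex_RInt_const R_NormedModule)|].
    intros s Hs; apply Rmult_le_compat; [apply pow_le; lra|apply L; lra|apply pow_incr; lra|].
    apply (profile_mono _ _ _ _ _ L); lra.
  - rewrite (RInt_const (V := R_CompleteNormedModule)).
    unfold scal; simpl; unfold mult; simpl.
    assert (0 <= Rad ^ (N - 1) * V (Rad - d)) by (apply Rmult_le_pos; lra).
    replace (Rad ^ (N - 1) * Rad * V (Rad - d)) with (Rad * (Rad ^ (N - 1) * V (Rad - d))) by ring.
    apply Rmult_le_compat_r; lra. }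
assert (Hq2 : 0 < 4 * th / q ^ 2) by (apply Rdiv_lt_0_compat; [lra|now apply pow_lt]).
assert (I2 : RInt f (Rad - d) Rad <=
  4 * th / q ^ 2 * RInt h (Rad - d) Rad + Rad ^ (N - 1) * d / (4 * th)).
{ apply Rle_trans with
    (RInt (fun s => plus (scal (4 * th / q ^ 2) (h s)) (Rad ^ (N - 1) / (4 * th))) (Rad - d) Rad).
  - apply RInt_le; [lra|apply Xf| |].
    { apply (@ex_RInt_plus R_NormedModule); [apply (@ex_RInt_scal R_NormedModule), Xh|apply (@ex_RInt_const R_NormedModule)]. }
    intros s Hs.
    change (s ^ (N - 1) * V s <=
      4 * th / q ^ 2 * (s ^ (N - 1) * exp (q * V s)) + Rad ^ (N - 1) * / (4 * th)).
    assert (0 <= V s) by (apply L; lra).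
    assert (Hs1 : 0 <= s ^ (N - 1)) by (apply pow_le; lra).
    assert (Hs2 : s ^ (N - 1) <= Rad ^ (N - 1)) by (apply pow_incr; lra).
    (* AM-GM: [V <= th * V ^ 2 + 1 / (4 * th)], and [(q * V) ^ 2 / 4 <= exp (q * V)]. *)
    assert (HV : V s <= 4 * th / q ^ 2 * exp (q * V s) + / (4 * th)).
    { assert (E := exp_ge_square (q * V s) ltac:(nra)).
      apply Rle_trans with (4 * th / q ^ 2 * ((q * V s) ^ 2 / 4) + / (4 * th)).
      - replace (4 * th / q ^ 2 * ((q * V s) ^ 2 / 4)) with (th * V s ^ 2) by (field; lra).
        apply Rmult_le_reg_l with (4 * th); [lra|].
        rewrite Rmult_plus_distr_l, Rinv_r by lra.
        generalize (pow2_ge_0 (2 * th * V s - 1)); intros; nra.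
      - apply Rplus_le_compat_r, Rmult_le_compat_l; lra. }
    assert (0 < / (4 * th)) by (apply Rinv_0_lt_compat; lra).
    apply Rle_trans with (s ^ (N - 1) * (4 * th / q ^ 2 * exp (q * V s) + / (4 * th))).
    + apply Rmult_le_compat_l; lra.
    + rewrite Rmult_plus_distr_l; apply Rplus_le_compat; [right; ring|].
      apply Rmult_le_compat_r; lra.
  - rewrite (RInt_plus (V := R_CompleteNormedModule)).
    + rewrite (RInt_scal (V := R_CompleteNormedModule)) by apply Xh.
      rewrite (RInt_const (V := R_CompleteNormedModule)).
      unfold plus, scal; simpl; unfold mult; simpl.
      right; field; lra.
    + apply (@ex_RInt_scal R_NormedModule), Xh.
    + apply (@ex_RInt_const R_NormedModule). }
(* The full anion integral equals B times the ball mass divided by K, and K >= A. *)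
assert (I3 : RInt h (Rad - d) Rad <= B * ball_mass / A).
{ apply Rle_trans with (RInt h 0 Rad).
  - rewrite <- (RInt_Chasles h 0 (Rad - d) Rad (Xh _ _) (Xh _ _)).
    change (RInt h (Rad - d) Rad <= RInt h 0 (Rad - d) + RInt h (Rad - d) Rad).
    assert (0 <= RInt h 0 (Rad - d)); [|lra].
    apply RInt_ge_0; [lra|apply Xh|].
    intros s Hs; apply Rmult_le_pos; [apply pow_le; lra|apply Rlt_le, exp_pos].
  - assert (E := layer_anions _ _ _ _ _ L); fold h in E.
    assert (0 < RInt h 0 Rad).
    { apply (RInt_weighted_pos (fun s => exp (q * V s))); [|intros; apply exp_pos].
      intros; now apply exp_comp_continuous. }
    rewrite <- E; apply Rmult_le_reg_r with A; [exact HA|].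
    unfold Rdiv; rewrite Rmult_assoc, Rinv_l by lra; nra. }
nra.
Qed.

Lemma equil_level_small (eta : R) : 0 < eta ->
  eventually_layer (fun eps c K V dV => c <= eta).
Proof.
intros Heta; assert (Hm := ball_mass_pos).
assert (PR : 0 < Rad ^ (N - 1)) by now apply pow_lt.
(* Each of the three terms of [profile_integral_le] gets a third of [eta * ball_mass]: [th] settles
   the anion term, d the collar term, and eps the inner term. *)
set (th := eta * q ^ 2 * A / (12 * B)).
assert (q2 : 0 < q ^ 2) by now apply pow_lt.
assert (Hth : 0 < th) by pos.
assert (Hd0 : 0 < eta * ball_mass * 4 * th / (3 * Rad ^ (N - 1)))
  by pos.
set (d := Rmin (Rad / 2) (eta * ball_mass * 4 * th / (3 * Rad ^ (N - 1)))).
assert (Hd : 0 < d <= Rad / 2) by (split; [apply Rmin_pos; lra|apply Rmin_l]).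
assert (Hd' : d <= eta * ball_mass * 4 * th / (3 * Rad ^ (N - 1))) by apply Rmin_r.
assert (He : 0 < eta * ball_mass / (3 * (Rad ^ (N - 1) * Rad))) by pos.
generalize (layer_inner_small d _ Hd He); apply eventually_layer_mono.
intros eps c K V dV L [H _].
assert (I := profile_integral_le _ _ _ _ _ d th L Hd Hth).
apply Rmult_le_reg_r with ball_mass; [exact Hm|].
apply Rle_trans with (1 := I).
replace (eta * ball_mass) with
  (Rad ^ (N - 1) * Rad * (eta * ball_mass / (3 * (Rad ^ (N - 1) * Rad)))
   + 4 * th / q ^ 2 * (B * ball_mass / A)
   + Rad ^ (N - 1) * (eta * ball_mass * 4 * th / (3 * Rad ^ (N - 1))) / (4 * th))
  by (unfold th; field; repeat split; lra).
apply Rplus_le_compat; [apply Rplus_le_compat_r|].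
- apply Rmult_le_compat_l; [nra|exact H].
- apply Rmult_le_compat_r; [apply Rlt_le, Rinv_0_lt_compat; lra|].
  apply Rmult_le_compat_l; lra.
Qed.

Lemma equil_density_small (eta : R) : 0 < eta ->
  eventually_layer (fun eps c K V dV => K <= A + eta).
Proof.
intros Heta.
(* The first bound on c gives p c <= 1/2, hence K <= 2 A; the second then gives K <= A + K p c <= A
   + eta. *)
assert (H1 : 0 < Rmin (/ (2 * p)) (eta / (2 * A * p))).
{ apply Rmin_pos; [apply Rinv_0_lt_compat; lra|apply Rdiv_lt_0_compat; [lra|nra]]. }
generalize (equil_level_small _ H1); apply eventually_layer_mono.
intros eps c K V dV L H.
assert (Hc := equil_level_nonneg _ _ _ _ _ L).
assert (HK := equil_density_le _ _ _ _ _ L).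
assert (HK0 := layer_K _ _ _ _ _ L).
assert (Ha : p * c <= / 2).
{ apply Rle_trans with (p * / (2 * p)); [apply Rmult_le_compat_l; [lra|]|right; field; lra].
  apply Rle_trans with (1 := H), Rmin_l. }
assert (Hb : 2 * A * (p * c) <= eta).
{ apply Rle_trans with (2 * A * p * (eta / (2 * A * p))); [|right; field; lra].
  rewrite <- Rmult_assoc; apply Rmult_le_compat_l; [nra|].
  apply Rle_trans with (1 := H), Rmin_r. }
assert (0 <= p * c) by nra.
nra.
Qed.

(** * Energy relation near the wall *)

Definition potential (y : R) : R := exp (q * y) / q + exp (- p * y) / p - (/ q + / p).

Lemma potential_derive (y : R) : is_derive potential y (reaction y).
Proof.
unfold potential, reaction; auto_derive; [exact I|field; lra].
Qed.

Lemma potential_0 : potential 0 = 0.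
Proof. unfold potential; rewrite !Rmult_0_r, exp_0; field; lra. Qed.

Lemma potential_mono (x y : R) : 0 <= x -> x <= y -> potential x <= potential y.
Proof.
intros Hx Hxy; apply (nondecreasing_of_derive potential reaction); [exact Hxy| | |].
- intros z _; apply (ex_derive_continuous potential); exists (reaction z); apply potential_derive.
- intros; apply potential_derive.
- intros z Hz; apply Rlt_le, reaction_pos; lra.
Qed.

Lemma potential_nonneg (y : R) : 0 <= y -> 0 <= potential y.
Proof. intros Hy; rewrite <- potential_0; apply potential_mono; lra. Qed.

Lemma potential_small (t : R) : 0 < t ->
  exists y0, 0 < y0 /\ forall y, 0 <= y <= y0 -> potential y <= t.
Proof.
intros Ht.
assert (Hc : continuous potential 0).
{ apply (ex_derive_continuous potential); exists (reaction 0); apply potential_derive. }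
destruct (proj1 (filterlim_locally _ _) Hc (mkposreal t Ht)) as [d Hd].
exists (d / 2); generalize (cond_pos d); intros Hdp; split; [lra|].
intros y Hy.
assert (H : Rabs (potential y - potential 0) < t).
{ apply Hd; change (Rabs (y - 0) < d); rewrite Rminus_0_r, Rabs_pos_eq; lra. }
rewrite potential_0, Rminus_0_r in H; generalize (Rle_abs (potential y)); lra.
Qed.

(** The derivative of eps^2 w^2 is 2 K r^(N-1) [flux_weight] times that of the potential of V.
    Subtracting the potential with a frozen coefficient k leaves a derivative whose sign is decided
    by r^(N-1) [flux_weight r] - k. *)
Lemma energy_derive (eps c K : R) (V dV : R -> R) (k r : R) :
  layer eps c K V dV -> 0 < r < Rad ->
  is_derive (fun r => eps ^ 2 * (flux_weight r * dV r) ^ 2 - 2 * K * k * potential (V r)) r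
    (2 * K * (reaction (V r) * dV r) * (r ^ (N - 1) * flux_weight r - k)).
Proof.
intros L Hr.
assert (He := layer_eps _ _ _ _ _ L).
assert (D1 := layer_flux _ _ _ _ _ L r Hr).
assert (D2 := layer_derive _ _ _ _ _ L r Hr).
set (w := fun r => flux_weight r * dV r) in *.
assert (D3 : is_derive (fun r => potential (V r)) r (dV r * reaction (V r))).
{ apply (is_derive_comp potential V); [apply potential_derive|exact D2]. }
set (dw := r ^ (N - 1) * K / eps ^ 2 * reaction (V r)) in *.
apply (is_derive_ext (fun r => eps ^ 2 * (w r * w r) - 2 * K * k * potential (V r))).
{ intros t; change (eps ^ 2 * (w t * w t) - 2 * K * k * potential (V t)
    = eps ^ 2 * w t ^ 2 - 2 * K * k * potential (V t)); ring. }
replace (2 * K * (reaction (V r) * dV r) * (r ^ (N - 1) * flux_weight r - k)) with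
  (eps ^ 2 * (dw * w r + w r * dw) - 2 * K * k * (dV r * reaction (V r)))
  by (unfold dw, w; field; lra).
apply (is_derive_minus (fun r => eps ^ 2 * (w r * w r)) (fun r => 2 * K * k * potential (V r))).
- apply (is_derive_scal (fun r => w r * w r)).
  apply (is_derive_mult w w); [exact D1|exact D1|intros; apply Rmult_comm].
- apply (is_derive_scal (fun r => potential (V r))); exact D3.
Qed.

Lemma energy_continuous (eps c K : R) (V dV : R -> R) (k r : R) :
  layer eps c K V dV ->
  continuous (fun r => eps ^ 2 * (flux_weight r * dV r) ^ 2 - 2 * K * k * potential (V r)) r.
Proof.
intros L.
apply (continuous_minus (fun r => eps ^ 2 * (flux_weight r * dV r) ^ 2)
  (fun r => 2 * K * k * potential (V r))).
- apply (continuous_scal_r (eps ^ 2) (fun r => (flux_weight r * dV r) ^ 2)).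
  apply (continuous_comp (fun r => flux_weight r * dV r) (fun x => x ^ 2)).
  + apply (flux_continuous _ _ _ _ _ L).
  + apply pow_continuous.
- apply (continuous_scal_r (2 * K * k) (fun r => potential (V r))).
  apply (continuous_comp V potential); [apply L|].
  apply (ex_derive_continuous potential); exists (reaction (V r)); apply potential_derive.
Qed.

(** The energy frozen at k = [lo] is nondecreasing and at k = [hi] nonincreasing, because reaction
    (V) V' >= 0. *)
Lemma energy_bounds (eps c K : R) (V dV : R -> R) (lo hi x y : R) :
  layer eps c K V dV -> 0 < x -> x <= y -> y <= Rad ->
  (forall r, x <= r <= y -> lo <= r ^ (N - 1) * flux_weight r <= hi) ->
  2 * K * lo * (potential (V y) - potential (V x)) <=
    eps ^ 2 * (flux_weight y * dV y) ^ 2 - eps ^ 2 * (flux_weight x * dV x) ^ 2 <=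
  2 * K * hi * (potential (V y) - potential (V x)).
Proof.
intros L Hx Hxy Hy Hw.
assert (HK := layer_K _ _ _ _ _ L).
assert (Hrd : forall r, 0 < r <= Rad -> 0 <= 2 * K * (reaction (V r) * dV r)).
{ intros r Hr; apply Rmult_le_pos; [lra|apply Rmult_le_pos].
  - now apply (layer_reaction_nonneg _ _ _ _ _ L).
  - now apply L. }
split.
- assert (H : eps ^ 2 * (flux_weight x * dV x) ^ 2 - 2 * K * lo * potential (V x) <=
    eps ^ 2 * (flux_weight y * dV y) ^ 2 - 2 * K * lo * potential (V y)); [|lra].
  apply (nondecreasing_of_derive
    (fun r => eps ^ 2 * (flux_weight r * dV r) ^ 2 - 2 * K * lo * potential (V r))
    (fun r => 2 * K * (reaction (V r) * dV r) * (r ^ (N - 1) * flux_weight r - lo)));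
    [exact Hxy| | |].
  + intros; now apply (energy_continuous _ c).
  + intros r Hr; apply (energy_derive _ c); [exact L|lra].
  + intros r Hr; apply Rmult_le_pos; [apply Hrd; lra|].
    specialize (Hw r ltac:(lra)); lra.
- assert (H : - (eps ^ 2 * (flux_weight x * dV x) ^ 2 - 2 * K * hi * potential (V x)) <=
    - (eps ^ 2 * (flux_weight y * dV y) ^ 2 - 2 * K * hi * potential (V y))); [|lra].
  apply (nondecreasing_of_derive
    (fun r => - (eps ^ 2 * (flux_weight r * dV r) ^ 2 - 2 * K * hi * potential (V r)))
    (fun r => - (2 * K * (reaction (V r) * dV r) * (r ^ (N - 1) * flux_weight r - hi))));
    [exact Hxy| | |].
  + intros r _; apply (continuous_opp
      (fun r => eps ^ 2 * (flux_weight r * dV r) ^ 2 - 2 * K * hi * potential (V r))).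
    now apply (energy_continuous _ c).
  + intros r Hr; apply (is_derive_opp
      (fun r => eps ^ 2 * (flux_weight r * dV r) ^ 2 - 2 * K * hi * potential (V r))).
    apply (energy_derive _ c); [exact L|lra].
  + intros r Hr; rewrite Ropp_mult_distr_r; apply Rmult_le_pos; [apply Hrd; lra|].
    specialize (Hw r ltac:(lra)); lra.
Qed.

Lemma continuous_near_wall (f : R -> R) (t : R) : continuous f Rad -> 0 < t ->
  exists d, 0 < d <= Rad / 2 /\ forall r, Rad - d <= r <= Rad -> Rabs (f r - f Rad) <= t.
Proof.
intros Hf Ht.
destruct (proj1 (filterlim_locally _ _) Hf (mkposreal t Ht)) as [d Hd].
assert (Hdp := cond_pos d).
exists (Rmin (d / 2) (Rad / 2)); split; [split; [apply Rmin_pos; lra|apply Rmin_r]|].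
intros r Hr; apply Rlt_le, Hd; change (Rabs (r - Rad) < d).
assert (Rmin (d / 2) (Rad / 2) <= d / 2) by apply Rmin_l.
rewrite Rabs_left1; lra.
Qed.

(** Bookkeeping for [slope_potential]. Here a is A, h and s are the wall values of r^(N-1)
    [flux_weight] and of 1 / [flux_weight]^2, G and G1 are the potential at the point and at the
    inner end of the collar, and X is eps^2 w^2. Every input is off by at most t; since G is
    unbounded the output error must be proportional to 1 + G. *)
Lemma perturbed_product (a h s t G G1 X K s' : R) :
  0 < a -> 0 < h -> 0 < s -> 0 < t -> t <= 1 -> t <= h -> t <= s ->
  0 <= G1 <= t -> G1 <= G -> a <= K <= a + t -> s - t <= s' <= s + t ->
  2 * K * (h - t) * (G - G1) <= X <= t + 2 * K * (h + t) * (G - G1) ->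
  Rabs (X * s' - 2 * a * (h * s) * G) <=
  t * ((s + 1) + 2 * ((a + 1) * (h + 1) * (s + 1)) + 2 * a * (h + s) + 2 * a * (h * s))
  * (1 + G).
Proof.
intros Ha Hh Hs Ht Ht1 Hth Hts HG1 HG HK Hs' [HX1 HX2].
set (P := (a + 1) * (h + 1) * (s + 1)).
assert (HG0 : 0 <= G) by lra.
assert (hs : 0 < h * s) by now apply Rmult_lt_0_compat.
assert (HP : 0 < P) by (unfold P; pos).
assert (E1 : (a + t) * (h + t) * (s + t) <= a * (h * s) + t * P).
{ unfold P.
  assert (0 <= (1 - t) * (t * (a + h + s))) by (apply Rmult_le_pos; [lra|apply Rmult_le_pos; lra]).
  assert (0 < t * (a * (h * s))) by pos.
  assert (0 <= (1 - t) * (1 + t) * t) by (apply Rmult_le_pos; [apply Rmult_le_pos; lra|lra]).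
  lra. }
assert (U : X * s' <= t * (s + 1) + 2 * (a * (h * s) + t * P) * G).
{ apply Rle_trans with ((t + 2 * ((a + t) * (h + t)) * G) * (s + t)).
  - apply Rmult_le_compat; try lra.
    + apply Rle_trans with (2 := HX1); apply Rmult_le_pos; [apply Rmult_le_pos; lra|lra].
    + apply Rle_trans with (1 := HX2); apply Rplus_le_compat_l.
      rewrite (Rmult_assoc 2 K).
      assert (0 <= K * (h + t)) by (apply Rmult_le_pos; lra).
      assert (K * (h + t) <= (a + t) * (h + t)) by (apply Rmult_le_compat_r; lra).
      apply Rmult_le_compat; lra.
  - assert (F1 : (a + t) * (h + t) * (s + t) * G <= (a * (h * s) + t * P) * G)
      by (apply Rmult_le_compat_r; lra).
    assert (F2 : t * (s + t) <= t * (s + 1)) by (apply Rmult_le_compat_l; lra).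
    lra. }
assert (Lw : 2 * (a * (h * s)) * G - 2 * a * (t * (h + s)) * G - 2 * (a * (h * s)) * t <= X * s').
{ apply Rle_trans with (2 * a * (h - t) * (G - G1) * (s - t)).
  - assert (h * s - t * (h + s) <= (h - t) * (s - t)) by nra.
    assert ((h - t) * (s - t) <= h * s) by nra.
    set (Z := (h - t) * (s - t)) in *.
    replace (2 * a * (h - t) * (G - G1) * (s - t)) with (2 * a * (Z * G) - 2 * a * (Z * G1))
      by (unfold Z; ring).
    assert (0 <= Z) by (unfold Z; apply Rmult_le_pos; lra).
    assert ((h * s - t * (h + s)) * G <= Z * G) by (apply Rmult_le_compat_r; lra).
    assert (Z * G1 <= h * s * t) by (apply Rmult_le_compat; lra).
    nra.
  - apply Rmult_le_compat; try lra.
    + apply Rmult_le_pos; [apply Rmult_le_pos; lra|lra].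
    + apply Rle_trans with (2 := HX1).
      apply Rmult_le_compat_r; [lra|]; apply Rmult_le_compat_r; lra. }
assert (0 < t * P) by now apply Rmult_lt_0_compat.
assert (0 < t * (s + 1)) by (apply Rmult_lt_0_compat; lra).
assert (0 < a * (t * (h + s))) by pos.
assert (0 < a * (h * s) * t) by pos.
assert (0 <= t * P * G) by (apply Rmult_le_pos; lra).
assert (0 <= t * (s + 1) * G) by (apply Rmult_le_pos; lra).
assert (0 <= a * (t * (h + s)) * G) by (apply Rmult_le_pos; lra).
assert (0 <= a * (h * s) * t * G) by (apply Rmult_le_pos; lra).
apply Rabs_le; split; lra.
Qed.

Lemma slope_potential (eta : R) : 0 < eta -> exists d, 0 < d <= Rad / 2 /\
  eventually_layer (fun eps c K V dV => forall r, Rad - d <= r <= Rad ->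
    Rabs (eps ^ 2 * dV r ^ 2 - 2 * A / g Rad * potential (V r)) <= eta * (1 + potential (V r))).
Proof.
intros Heta; assert (gR := g_wall_pos).
assert (fR : 0 < flux_weight Rad) by (apply flux_weight_pos; lra).
assert (PR : 0 < Rad ^ (N - 1)) by now apply pow_lt.
set (hf := fun r => r ^ (N - 1) * flux_weight r).
set (sf := fun r => / (flux_weight r * flux_weight r)).
assert (hR : 0 < hf Rad) by now apply Rmult_lt_0_compat.
assert (sR : 0 < sf Rad) by now apply Rinv_0_lt_compat, Rmult_lt_0_compat.
(* The error constant of [perturbed_product], so that t Cb <= eta. *)
set (Cb := (sf Rad + 1) + 2 * ((A + 1) * (hf Rad + 1) * (sf Rad + 1))
  + 2 * A * (hf Rad + sf Rad) + 2 * A * (hf Rad * sf Rad)).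
assert (HCb : 0 < Cb).
{ assert (0 < (A + 1) * (hf Rad + 1) * (sf Rad + 1)) by pos.
  assert (0 < A * (hf Rad + sf Rad)) by pos.
  assert (0 < A * (hf Rad * sf Rad)) by pos.
  unfold Cb; lra. }
set (t := Rmin (Rmin 1 (eta / Cb)) (Rmin (hf Rad) (sf Rad))).
assert (Ht : 0 < t).
{ unfold t; repeat apply Rmin_pos; try lra; now apply Rdiv_lt_0_compat. }
assert (Ht1 : t <= 1) by (apply Rle_trans with (1 := Rmin_l _ _), Rmin_l).
assert (Ht2 : t <= eta / Cb) by (apply Rle_trans with (1 := Rmin_l _ _), Rmin_r).
assert (Ht3 : t <= hf Rad) by (apply Rle_trans with (1 := Rmin_r _ _), Rmin_l).
assert (Ht4 : t <= sf Rad) by (apply Rle_trans with (1 := Rmin_r _ _), Rmin_r).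
assert (Ch : continuous hf Rad) by (apply weighted_continuous, flux_weight_continuous).
assert (Cs : continuous sf Rad).
{ apply (continuous_comp (fun r => flux_weight r * flux_weight r) Rinv).
  - apply (continuous_mult flux_weight flux_weight); apply flux_weight_continuous.
  - apply continuous_Rinv; nra. }
destruct (continuous_near_wall hf t Ch Ht) as (d1 & Hd1 & Hh).
destruct (continuous_near_wall sf t Cs Ht) as (d2 & Hd2 & Hs).
destruct (potential_small t Ht) as (y0 & Hy0 & HG).
set (d := Rmin d1 d2).
assert (Hdl : d <= d1) by apply Rmin_l.
assert (Hdr : d <= d2) by apply Rmin_r.
assert (Hd : 0 < d <= Rad / 2) by (split; [apply Rmin_pos; lra|lra]).
exists d; split; [exact Hd|].
generalize (eventually_layer_and _ _ (layer_inner_small d (Rmin y0 t) Hd (Rmin_pos _ _ Hy0 Ht))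
  (equil_density_small t Ht)).
apply eventually_layer_mono; intros eps c K V dV L [[HV HF] HK] r Hr.
assert (He := layer_eps _ _ _ _ _ L).
assert (HKA := equil_density_ge _ _ _ _ _ L).
assert (HV' : V (Rad - d) <= y0) by (apply Rle_trans with (1 := HV), Rmin_l).
assert (HF' : eps * (flux_weight (Rad - d) * dV (Rad - d)) <= t)
  by (apply Rle_trans with (1 := HF), Rmin_r).
assert (HF0 : 0 <= flux_weight (Rad - d) * dV (Rad - d))
  by (apply (flux_nonneg _ _ _ _ _ L); lra).
assert (V0 : 0 <= V (Rad - d)) by (apply L; lra).
assert (EB := energy_bounds eps c K V dV (hf Rad - t) (hf Rad + t) (Rad - d) r L
  ltac:(lra) ltac:(lra) ltac:(lra)).
specialize (EB ltac:(intros z Hz; specialize (Hh z ltac:(lra)); apply Rabs_le_between in Hh;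
  unfold hf in *; lra)).
set (X := eps ^ 2 * (flux_weight r * dV r) ^ 2) in *.
assert (HX0 : 0 <= eps ^ 2 * (flux_weight (Rad - d) * dV (Rad - d)) ^ 2 <= t).
{ replace (eps ^ 2 * (flux_weight (Rad - d) * dV (Rad - d)) ^ 2) with
    ((eps * (flux_weight (Rad - d) * dV (Rad - d))) ^ 2) by ring.
  assert (0 <= eps * (flux_weight (Rad - d) * dV (Rad - d))) by (apply Rmult_le_pos; lra).
  split; [apply pow2_ge_0|]; nra. }
assert (Hmono : V (Rad - d) <= V r) by (apply (profile_mono _ _ _ _ _ L); lra).
assert (Hfr : 0 < flux_weight r) by (apply flux_weight_pos; lra).
assert (EX : eps ^ 2 * dV r ^ 2 = X * sf r) by (unfold X, sf; field; lra).
(* At the wall the powers of R cancel: r^(N-1) / [flux_weight] = 1 / g. *)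
assert (Eg : 2 * A / g Rad = 2 * A * (hf Rad * sf Rad)).
{ unfold hf, sf, flux_weight; field; split; lra. }
rewrite EX, Eg.
apply Rle_trans with (t * Cb * (1 + potential (V r))).
- apply (perturbed_product A (hf Rad) (sf Rad) t (potential (V r)) (potential (V (Rad - d))) X K);
    try assumption.
  + split; [now apply potential_nonneg|apply HG; lra].
  + now apply potential_mono.
  + lra.
  + specialize (Hs r ltac:(lra)); apply Rabs_le_between in Hs; lra.
  + split; lra.
- assert (0 <= potential (V r)) by (apply potential_nonneg; lra).
  apply Rmult_le_compat_r; [lra|].
  apply Rle_trans with (eta / Cb * Cb); [apply Rmult_le_compat_r; lra|right; field; lra].
Qed.

(* For the limiting equation [eps ^ 2 * g * V'' = A * exp (q * V)], [height V]
   is an affine function of [r / eps] with slope [- limit_slope]. *)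
Definition height (V : R -> R) (r : R) : R := exp (- (q / 2) * V r).
(** This is - eps Y' in closed form, so that it is also defined at the wall. *)
Definition height_slope (eps : R) (V dV : R -> R) (r : R) : R :=
  q / 2 * (eps * dV r) * height V r.
Definition limit_slope : R := sqrt (q * A / (2 * g Rad)).

Lemma limit_slope_pos : 0 < limit_slope.
Proof. generalize g_wall_pos; intros; apply sqrt_lt_R0; pos. Qed.

Lemma limit_slope_sq : limit_slope ^ 2 = q * A / (2 * g Rad).
Proof.
generalize g_wall_pos; intros; apply pow2_sqrt, Rlt_le; pos.
Qed.

Lemma height_pos (V : R -> R) (r : R) : 0 < height V r.
Proof. apply exp_pos. Qed.

Lemma height_sq (V : R -> R) (r : R) : height V r ^ 2 = exp (- (q * V r)).
Proof.
unfold height; simpl; rewrite Rmult_1_r, <- exp_plus; f_equal; field.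
Qed.

Lemma height_le_1 (V : R -> R) (r : R) : 0 <= V r -> height V r <= 1.
Proof. intros H; rewrite <- exp_0; apply exp_nondecreasing; nra. Qed.

Lemma height_slope_nonneg (eps c K : R) (V dV : R -> R) (r : R) :
  layer eps c K V dV -> 0 < r <= Rad -> 0 <= height_slope eps V dV r.
Proof.
intros L Hr; assert (He := layer_eps _ _ _ _ _ L).
assert (0 <= dV r) by now apply L.
apply Rmult_le_pos; [|apply Rlt_le, height_pos].
apply Rmult_le_pos; [lra|apply Rmult_le_pos; lra].
Qed.

(** Multiplying [slope_potential] by Y^2 = exp (- q V) makes its error bounded, and Y^2 G(V) = 1/q +
    O(Y^2). The constant C precedes eta because Y is made small only later, independently of the
    collar. *)
Lemma height_slope_sq : exists C, 0 < C /\
  forall eta, 0 < eta -> exists d, 0 < d <= Rad / 2 /\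
  eventually_layer (fun eps c K V dV => forall r, Rad - d <= r <= Rad ->
    Rabs (height_slope eps V dV r ^ 2 - limit_slope ^ 2) <= eta + C * height V r ^ 2).
Proof.
assert (gR := g_wall_pos).
assert (Hpq : 0 < / p + / q) by (apply Rplus_lt_0_compat; pos).
set (k := q ^ 2 * A / (2 * g Rad)).
assert (Hk : 0 < k) by (unfold k; pos).
exists (k * (/ p + / q)); split; [pos|].
intros eta Heta.
(* Chosen so that (q^2 / 4) eta' (1 + 1/q) = eta, where 1 + 1/q bounds (1 + G) Y^2. *)
set (eta' := eta * 4 / (q ^ 2 * (1 + / q))).
assert (Hiq : 0 < / q) by pos.
assert (Hip : 0 < / p) by pos.
assert (q2 : 0 < q ^ 2) by pos.
assert (Heta' : 0 < eta').
{ unfold eta'; apply Rdiv_lt_0_compat; [lra|apply Rmult_lt_0_compat; lra]. }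
destruct (slope_potential eta' Heta') as (d & Hd & H).
exists d; split; [exact Hd|]; revert H; apply eventually_layer_mono.
intros eps c K V dV L H r Hr; specialize (H r Hr).
assert (V0 : 0 <= V r) by (apply L; lra).
set (Y2 := height V r ^ 2).
assert (HY2 : 0 < Y2) by apply pow_lt, height_pos.
assert (HY2' : Y2 <= 1).
{ assert (height V r <= 1) by now apply height_le_1. assert (0 < height V r) by apply height_pos.
  unfold Y2; nra. }
set (e := exp (- p * V r)).
assert (He : 0 < e <= 1).
{ split; [apply exp_pos|rewrite <- exp_0; apply exp_nondecreasing; nra]. }
set (G := potential (V r)) in *.
assert (HG0 : 0 <= G) by now apply potential_nonneg.
assert (EG : G * Y2 = / q + (e / p - (/ q + / p)) * Y2).
{ unfold G, potential, Y2; fold e; rewrite height_sq, exp_Ropp.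
  field; repeat split; try lra; apply Rgt_not_eq, exp_pos. }
assert (Hep : 0 < e / p <= / p).
{ split; [apply Rdiv_lt_0_compat; lra|unfold Rdiv; nra]. }
assert (EX : height_slope eps V dV r ^ 2 - limit_slope ^ 2 =
  q ^ 2 / 4 * ((eps ^ 2 * dV r ^ 2 - 2 * A / g Rad * G) * Y2)
  + k * ((e / p - (/ q + / p)) * Y2)).
{ unfold height_slope; rewrite limit_slope_sq.
  replace ((q / 2 * (eps * dV r) * height V r) ^ 2) with
    (q ^ 2 / 4 * (eps ^ 2 * dV r ^ 2 * Y2)) by (unfold Y2; field).
  replace ((eps ^ 2 * dV r ^ 2 - 2 * A / g Rad * G) * Y2) with
    (eps ^ 2 * dV r ^ 2 * Y2 - 2 * A / g Rad * (G * Y2)) by ring.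
  rewrite EG; unfold k; field; repeat split; lra. }
rewrite EX; apply Rle_trans with (1 := Rabs_triang _ _); apply Rplus_le_compat.
- rewrite Rabs_mult, (Rabs_pos_eq (q ^ 2 / 4)) by lra.
  rewrite Rabs_mult, (Rabs_pos_eq Y2) by lra.
  apply Rle_trans with (q ^ 2 / 4 * (eta' * (1 + / q))).
  + apply Rmult_le_compat_l; [lra|].
    apply Rle_trans with (eta' * (1 + G) * Y2); [apply Rmult_le_compat_r; lra|].
    rewrite Rmult_assoc; apply Rmult_le_compat_l; [lra|].
    assert ((e / p - (/ q + / p)) * Y2 <= 0) by nra. nra.
  + right; unfold eta'; field; repeat split; lra.
- rewrite Rabs_mult, (Rabs_pos_eq k) by lra; rewrite Rmult_assoc.
  apply Rmult_le_compat_l; [lra|].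
  rewrite Rabs_mult, (Rabs_pos_eq Y2) by lra.
  apply Rmult_le_compat_r; [lra|]; apply Rabs_le; lra.
Qed.

(** The boundary condition in terms of Y: V' of order eps^(-2) at the wall means that a bounded
    slope forces Y(R) = O(eps). *)
Lemma height_slope_wall (eps c K : R) (V dV : R -> R) :
  layer eps c K V dV ->
  height V Rad = 2 * eps / (q * wall_slope) * height_slope eps V dV Rad.
Proof.
intros L; assert (He := layer_eps _ _ _ _ _ L); assert (Hw := wall_slope_pos).
unfold height_slope; rewrite (layer_wall _ _ _ _ _ L); field; lra.
Qed.

Lemma height_slope_bound : exists M d, 0 < M /\ 0 < d <= Rad / 2 /\
  eventually_layer (fun eps c K V dV => forall r, Rad - d <= r <= Rad ->
    height_slope eps V dV r <= M).
Proof.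
destruct height_slope_sq as (C & HC & H).
destruct (H 1 Rlt_0_1) as (d & Hd & H1).
assert (Hm := limit_slope_pos).
exists (1 + (limit_slope ^ 2 + 1 + C)), d; split; [nra|split; [exact Hd|]].
revert H1; apply eventually_layer_mono.
intros eps c K V dV L H1 r Hr; specialize (H1 r Hr).
assert (0 <= V r) by (apply L; lra).
assert (height V r <= 1) by now apply height_le_1.
assert (0 < height V r) by apply height_pos.
assert (0 <= height_slope eps V dV r) by (apply (height_slope_nonneg _ c K); [exact L|lra]).
assert (height V r ^ 2 <= 1) by nra.
apply Rabs_le_between in H1.
set (T := height_slope eps V dV r) in *; nra.
Qed.

Lemma wall_height_bound : exists C, 0 < C /\
  eventually_layer (fun eps c K V dV => height V Rad <= C * eps).
Proof.
destruct height_slope_bound as (M & d & HM & Hd & H); assert (Hw := wall_slope_pos).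
exists (2 / (q * wall_slope) * M); split; [pos|].
revert H; apply eventually_layer_mono; intros eps c K V dV L H.
assert (He := layer_eps _ _ _ _ _ L).
rewrite (height_slope_wall _ _ _ _ _ L).
replace (2 / (q * wall_slope) * M * eps) with (2 * eps / (q * wall_slope) * M) by (field; lra).
apply Rmult_le_compat_l; [apply Rlt_le; pos|apply H; lra].
Qed.

Lemma height_derive (eps c K : R) (V dV : R -> R) (r : R) :
  layer eps c K V dV -> 0 < r < Rad ->
  is_derive (height V) r (- height_slope eps V dV r / eps).
Proof.
intros L Hr; assert (He := layer_eps _ _ _ _ _ L).
replace (- height_slope eps V dV r / eps) with (- (q / 2) * dV r * height V r)
  by (unfold height_slope; field; lra).
apply (is_derive_comp exp (fun r => - (q / 2) * V r)).
- apply is_derive_Reals, derivable_pt_lim_exp.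
- apply (is_derive_scal V); now apply L.
Qed.

Lemma height_continuous (eps c K : R) (V dV : R -> R) (r : R) :
  layer eps c K V dV -> continuous (height V) r.
Proof. intros L; apply exp_comp_continuous, L. Qed.

(** A bootstrap: the crude bound M on the slope gives Y(r) <= Y(R) + M (R - r) / eps, so Y is small
    within distance d eps of the wall; with Y small, [height_slope_sq] sharpens the slope to its
    limit. *)
Lemma height_slope_near (eta : R) : 0 < eta -> exists d, 0 < d <= Rad / 2 /\
  eventually_layer (fun eps c K V dV => eps < 1 /\
    forall r, Rad - d * eps <= r <= Rad ->
    height V r <= eta /\ Rabs (height_slope eps V dV r - limit_slope) <= eta).
Proof.
intros Heta; assert (Hm := limit_slope_pos).
destruct height_slope_bound as (M & d1 & HM & Hd1 & HMb).
destruct wall_height_bound as (CR & HCR & HR1).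
destruct height_slope_sq as (C & HC & Hsq).
assert (Heta2 : 0 < eta * limit_slope / 2) by pos.
destruct (Hsq _ Heta2) as (d2 & Hd2 & H2).
(* The bound 1 gives t^2 <= t, so Y <= t yields C Y^2 <= eta m / 2. Half of t pays for Y(R), half
   for M d. *)
set (t := Rmin 1 (Rmin eta (eta * limit_slope / (2 * C)))).
assert (Ht : 0 < t).
{ unfold t; repeat apply Rmin_pos; try lra; pos. }
assert (Ht1 : t <= 1) by apply Rmin_l.
assert (Ht2 : t <= eta) by (apply Rle_trans with (1 := Rmin_r _ _), Rmin_l).
assert (Ht3 : t <= eta * limit_slope / (2 * C)) by (apply Rle_trans with (1 := Rmin_r _ _), Rmin_r).
set (d := Rmin (Rmin d1 d2) (t / (2 * M))).
assert (Hd : 0 < d) by (unfold d; repeat apply Rmin_pos; try lra; pos).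
assert (Hdd1 : d <= d1) by (apply Rle_trans with (1 := Rmin_l _ _), Rmin_l).
assert (Hdd2 : d <= d2) by (apply Rle_trans with (1 := Rmin_l _ _), Rmin_r).
assert (HdM : M * d <= t / 2).
{ apply Rle_trans with (M * (t / (2 * M))); [|right; field; lra].
  apply Rmult_le_compat_l; [lra|apply Rmin_r]. }
exists d; split; [lra|].
assert (He0 : 0 < Rmin 1 (t / (2 * CR))) by (apply Rmin_pos; [lra|pos]).
generalize (eventually_layer_and _ _ (eventually_layer_small _ He0)
  (eventually_layer_and _ _ HMb (eventually_layer_and _ _ HR1 H2))).
apply eventually_layer_mono; intros eps c K V dV L (Hs & HMr & HRr & H2r).
assert (He := layer_eps _ _ _ _ _ L).
assert (Hs1 : eps < 1) by (apply Rlt_le_trans with (1 := Hs), Rmin_l).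
assert (Hs2 : CR * eps <= t / 2).
{ apply Rle_trans with (CR * (t / (2 * CR))); [|right; field; lra].
  apply Rmult_le_compat_l; [lra|apply Rlt_le, Rlt_le_trans with (1 := Hs), Rmin_r]. }
split; [exact Hs1|].
intros r Hr.
assert (Hde : d * eps <= d) by nra.
assert (HY : height V r <= t).
{ assert (height V r <= height V Rad + M / eps * (Rad - r)).
  { destruct (proj2 Hr) as [Hlt| ->]; [|lra].
    destruct (MVT_open (height V) (fun r => - height_slope eps V dV r / eps) r Rad Hlt)
      as (z & Hz & Ez).
    - intros; apply (height_continuous _ _ _ _ _ _ L).
    - intros y Hy; apply (height_derive _ c K); [exact L|lra].
    - assert (height_slope eps V dV z / eps <= M / eps).
      { apply Rmult_le_compat_r; [apply Rlt_le; pos|apply HMr; lra]. }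
      replace (- height_slope eps V dV z / eps) with (- (height_slope eps V dV z / eps)) in Ez
        by (field; lra).
      nra. }
  assert (M / eps * (Rad - r) <= M / eps * (d * eps)).
  { apply Rmult_le_compat_l; [apply Rlt_le; pos|lra]. }
  replace (M / eps * (d * eps)) with (M * d) in * by (field; lra).
  lra. }
split; [lra|].
specialize (H2r r ltac:(lra)).
assert (HY0 := height_pos V r).
assert (HT0 : 0 <= height_slope eps V dV r) by (apply (height_slope_nonneg _ c K); [exact L|lra]).
set (T := height_slope eps V dV r) in *.
assert (HCY : C * height V r ^ 2 <= eta * limit_slope / 2).
{ apply Rle_trans with (C * (eta * limit_slope / (2 * C))); [|right; field; lra].
  apply Rmult_le_compat_l; [lra|]; nra. }
(* As T >= 0, |T - m| m <= |T - m| (T + m) = |T^2 - m^2|; the sign of T excludes the root - m. *)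
apply Rmult_le_reg_r with limit_slope; [exact Hm|].
apply Rle_trans with (Rabs (T ^ 2 - limit_slope ^ 2)); [|lra].
replace (T ^ 2 - limit_slope ^ 2) with ((T - limit_slope) * (T + limit_slope)) by ring.
rewrite Rabs_mult, (Rabs_pos_eq (T + limit_slope)) by lra.
apply Rmult_le_compat_l; [apply Rabs_pos|lra].
Qed.

Lemma height_increment (eps c K : R) (V dV : R -> R) (eta r : R) :
  layer eps c K V dV -> 0 < r < Rad ->
  (forall s, r <= s <= Rad -> Rabs (height_slope eps V dV s - limit_slope) <= eta) ->
  Rabs ((height V r - height V Rad) / ((Rad - r) / eps) - limit_slope) <= eta.
Proof.
intros L Hr H; assert (He := layer_eps _ _ _ _ _ L).
destruct (MVT_open (height V) (fun r => - height_slope eps V dV r / eps) r Rad (proj2 Hr))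
  as (z & Hz & Ez).
- intros; apply (height_continuous _ _ _ _ _ _ L).
- intros y Hy; apply (height_derive _ c K); [exact L|lra].
- replace ((height V r - height V Rad) / ((Rad - r) / eps)) with (height_slope eps V dV z).
  + apply H; lra.
  + replace (height V r - height V Rad) with (- (height V Rad - height V r)) by ring.
    rewrite Ez; field; lra.
Qed.

(** * Asymptotics along a family of points *)

Section Asymptotics.

Variable U : R -> R -> R.
Hypothesis HU : forall eps, 0 < eps -> solves_Nstar N Rad g A B p q eps (U eps).

Let lev (eps : R) : R := equil_level (U eps).
Let den (eps : R) : R := equil_density (U eps).
Let dep (eps : R) : R -> R := depth (U eps).
Let Y (eps : R) : R -> R := height (dep eps).
Let T (eps r : R) : R := - (q / 2) * (eps * Derive (U eps) r) * Y eps r.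

(** Specialises a uniform estimate to the family of solutions, with the derivative of the profile
    identified with - U' in the interior. *)
Lemma eventually_solution (P : R -> R -> R -> (R -> R) -> (R -> R) -> Prop) (Q : R -> Prop) :
  eventually_layer P ->
  (forall eps dV, 0 < eps -> layer eps (lev eps) (den eps) (dep eps) dV ->
    (forall r, 0 < r < Rad -> dV r = - Derive (U eps) r) ->
    P eps (lev eps) (den eps) (dep eps) dV -> Q eps) ->
  at_right 0 Q.
Proof.
intros (e0 & He0 & HP) HQ.
generalize (filter_and (F := at_right 0) _ _ at_right_pos (at_right_lt _ He0)).
apply filter_imp; intros eps [H1 H2].
destruct (solution_layer eps (U eps) H1 (HU eps H1)) as (dV & L & H).
apply (HQ eps dV H1 L); [|now apply HP].
intros r Hr; destruct (H r Hr) as (_ & -> & _); ring.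
Qed.

Lemma equil_level_lim : lim0 lev 0.
Proof.
apply lim0_intro; intros eta Heta.
apply (eventually_solution _ _ (equil_level_small eta Heta)).
intros eps dV He L _ H; rewrite Rminus_0_r, Rabs_pos_eq; [exact H|].
exact (equil_level_nonneg _ _ _ _ _ L).
Qed.

Lemma equil_density_lim : lim0 den A.
Proof.
apply lim0_intro; intros eta Heta.
apply (eventually_solution _ _ (equil_density_small eta Heta)).
intros eps dV He L _ H; assert (H' := equil_density_ge _ _ _ _ _ L).
apply Rabs_le; lra.
Qed.

Definition wall_height_rate : R := 2 / (q * wall_slope) * limit_slope.

Lemma wall_height_rate_pos : 0 < wall_height_rate.
Proof. generalize wall_slope_pos limit_slope_pos; intros; unfold wall_height_rate; pos. Qed.

Lemma wall_height_lim : lim0 (fun eps => Y eps Rad / eps) wall_height_rate.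
Proof.
assert (Hw := wall_slope_pos).
assert (Hk : 0 < 2 / (q * wall_slope)) by pos.
set (k := 2 / (q * wall_slope)) in *.
apply lim0_intro; intros eta Heta.
destruct (height_slope_near (eta / k)) as (d & Hd & H); [pos|].
apply (eventually_solution _ _ H).
intros eps dV He L _ [_ HT]; destruct (HT Rad) as [_ HT']; [split; [|lra]; nra|].
unfold Y; rewrite (height_slope_wall _ _ _ _ _ L).
unfold wall_height_rate; fold k.
replace (2 * eps / (q * wall_slope) * height_slope eps (dep eps) dV Rad / eps)
  with (k * height_slope eps (dep eps) dV Rad) by (unfold k; field; lra).
rewrite <- Rmult_minus_distr_l, Rabs_mult, (Rabs_pos_eq k) by lra.
apply Rle_trans with (k * (eta / k)); [apply Rmult_le_compat_l; lra|right; field; lra].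
Qed.

(** * Limits along given points approaching the wall *)

Section Along.

Variable r : R -> R.
Hypothesis Hr : at_right 0 (fun eps => 0 < r eps < Rad).

Let x (eps : R) : R := (Rad - r eps) / eps.

Lemma stretched_pos : at_right 0 (fun eps => 0 < eps /\ 0 < r eps < Rad /\ 0 < x eps).
Proof.
generalize (filter_and (F := at_right 0) _ _ at_right_pos Hr); apply filter_imp.
intros eps [H1 H2]; repeat split; try lra; unfold x; apply Rdiv_lt_0_compat; lra.
Qed.

Section NearWall.

Hypothesis Hx : lim0 x 0.

Lemma near_wall (eta : R) : 0 < eta -> at_right 0 (fun eps =>
  Y eps (r eps) <= eta /\ Rabs (T eps (r eps) - limit_slope) <= eta /\
  Rabs ((Y eps (r eps) - Y eps Rad) / x eps - limit_slope) <= eta).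
Proof.
intros Heta; destruct (height_slope_near eta Heta) as (d & Hd & H).
assert (Hxd := lim0_elim _ _ d Hx (proj1 Hd)).
assert (H1 : at_right 0 (fun eps => 0 < r eps < Rad -> Rabs (x eps - 0) < d ->
  Y eps (r eps) <= eta /\ Rabs (T eps (r eps) - limit_slope) <= eta /\
  Rabs ((Y eps (r eps) - Y eps Rad) / x eps - limit_slope) <= eta)).
{ apply (eventually_solution _ _ H).
  intros eps dV He L HD [_ HT] Hre Hxe.
  rewrite Rminus_0_r in Hxe; assert (Hxe' := Rle_abs (x eps)).
  assert (Hlow : Rad - d * eps <= r eps).
  { assert (E : x eps * eps = Rad - r eps) by (unfold x; field; lra). nra. }
  destruct (HT (r eps)) as [HY HS]; [lra|].
  split; [exact HY|split].
  - replace (T eps (r eps)) with (height_slope eps (dep eps) dV (r eps)); [exact HS|].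
    unfold T, height_slope, Y; rewrite HD by exact Hre; ring.
  - apply (height_increment eps (lev eps) (den eps) _ dV); [exact L|exact Hre|].
    intros s Hs; apply HT; lra. }
generalize (filter_and (F := at_right 0) _ _ Hr (filter_and (F := at_right 0) _ _ Hxd H1)).
apply filter_imp; intros eps (H2 & H3 & H4); exact (H4 H2 H3).
Qed.

Lemma height_lim : lim0 (fun eps => Y eps (r eps)) 0.
Proof.
apply lim0_intro; intros eta Heta; generalize (near_wall eta Heta); apply filter_imp.
intros eps (H & _); rewrite Rminus_0_r, Rabs_pos_eq; [exact H|apply Rlt_le, height_pos].
Qed.

Lemma height_slope_lim : lim0 (fun eps => T eps (r eps)) limit_slope.
Proof.
apply lim0_intro; intros eta Heta; generalize (near_wall eta Heta); apply filter_imp.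
intros eps (_ & H & _); exact H.
Qed.

Lemma height_increment_lim :
  lim0 (fun eps => (Y eps (r eps) - Y eps Rad) / x eps) limit_slope.
Proof.
apply lim0_intro; intros eta Heta; generalize (near_wall eta Heta); apply filter_imp.
intros eps (_ & _ & H); exact H.
Qed.

(** Y determines everything: U = c + (2/q) ln Y, U' = - (2/q) T / (eps Y), and rho = K (1 - Y^2 exp
    (- p V)) / Y^2. With T -> m, c -> 0, K -> A and Y -> 0, only the size s of Y has to be supplied;
    it is (R - r) / eps or eps below. *)
Lemma asymptotics_of_height (s : R -> R) (a : R) :
  0 < a -> at_right 0 (fun eps => 0 < s eps) ->
  lim0 (fun eps => Y eps (r eps) / s eps) a ->
  lim0 (fun eps => U eps (r eps) - (2 / q * ln (s eps) + 2 / q * ln a)) 0 /\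
  lim0 (fun eps => Derive (U eps) (r eps) * (eps * s eps)) (- (2 / q) * (limit_slope / a)) /\
  lim0 (fun eps => rho N Rad A B p q (U eps) (r eps) * s eps ^ 2) (A / a ^ 2).
Proof.
intros Ha Hs HY.
assert (Hm := limit_slope_pos).
assert (Hpos := filter_and (F := at_right 0) _ _ Hs stretched_pos).
split; [|split].
- apply lim0_ext with (fun eps => lev eps + 2 / q * (ln (Y eps (r eps) / s eps) - ln a)).
  { revert Hpos; apply filter_imp; intros eps (H1 & H2 & H3 & H4).
    rewrite ln_div by (try apply height_pos; assumption).
    unfold Y at 1, height; rewrite ln_exp; unfold dep, depth.
    rewrite clamp_id by lra; unfold lev; field; lra. }
  replace 0 with (0 + 2 / q * (ln a - ln a)) by ring.
  apply lim0_plus; [exact equil_level_lim|].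
  apply lim0_scal, lim0_minus; [|apply lim0_const].
  apply (lim0_comp ln); [|exact HY].
  apply (ex_derive_continuous ln); auto_derive; exact Ha.
- apply lim0_ext with (fun eps => - (2 / q) * (T eps (r eps) / (Y eps (r eps) / s eps))).
  { revert Hpos; apply filter_imp; intros eps (H1 & H2 & H3 & H4).
    assert (HYp : 0 < Y eps (r eps)) by apply height_pos.
    unfold T; field; lra. }
  apply lim0_scal, lim0_div; [lra|exact height_slope_lim|exact HY].
- apply lim0_ext with (fun eps =>
    den eps * (1 - Y eps (r eps) ^ 2 * exp (- p * dep eps (r eps))) / (Y eps (r eps) / s eps) ^ 2).
  { revert Hpos; apply filter_imp; intros eps (H1 & H2 & H3 & H4).
    assert (HYp : 0 < Y eps (r eps)) by apply height_pos.
    destruct (solution_layer eps (U eps) H2 (HU eps H2)) as (dV & L & H).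
    destruct (H (r eps) H3) as (_ & _ & ->).
    change (depth (U eps)) with (dep eps); change (equil_density (U eps)) with (den eps).
    assert (E : exp (q * dep eps (r eps)) = / Y eps (r eps) ^ 2).
    { unfold Y; rewrite height_sq, exp_Ropp, Rinv_inv; reflexivity. }
    unfold reaction; rewrite E; field; lra. }
  assert (lim_sq : forall f l, lim0 f l -> lim0 (fun e => f e ^ 2) (l ^ 2)).
  { intros f l Hf; apply (lim0_comp (fun y => y ^ 2)); [apply pow_continuous|exact Hf]. }
  replace (A / a ^ 2) with (A * (1 - 0) / a ^ 2) by (field; lra).
  apply lim0_div; [apply pow_nonzero; lra| |now apply lim_sq].
  apply lim0_mult; [exact equil_density_lim|].
  apply lim0_minus; [apply lim0_const|].
  apply lim0_squeeze with (fun eps => Y eps (r eps) ^ 2).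
  + generalize stretched_pos; apply filter_imp; intros eps (H2 & H3 & H4).
    destruct (solution_layer eps (U eps) H2 (HU eps H2)) as (dV & L & _).
    assert (0 <= dep eps (r eps)) by (apply L; lra).
    assert (exp (- p * dep eps (r eps)) <= 1).
    { rewrite <- exp_0; apply exp_nondecreasing; nra. }
    assert (0 < exp (- p * dep eps (r eps))) by apply exp_pos.
    assert (0 <= Y eps (r eps) ^ 2) by apply pow2_ge_0.
    rewrite Rabs_pos_eq by nra; nra.
  + replace 0 with (0 ^ 2) by ring; apply lim_sq, height_lim.
Qed.

Lemma asymptotics_log_layer :
  tendsinf (fun eps => (Rad - r eps) / eps ^ 2) ->
  lim0 (fun eps => U eps (r eps) -
    (2 / q * ln ((Rad - r eps) / eps) + 2 / q * ln limit_slope)) 0 /\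
  lim0 (fun eps => Derive (U eps) (r eps) / (- 2 / (q * (Rad - r eps))) - 1) 0 /\
  lim0 (fun eps => rho N Rad A B p q (U eps) (r eps) /
    (2 * g Rad / q * (eps / (Rad - r eps)) ^ 2) - 1) 0.
Proof.
intros Hinf; assert (Hm := limit_slope_pos); assert (gR := g_wall_pos).
assert (HY : lim0 (fun eps => Y eps (r eps) / x eps) limit_slope).
(* The wall contribution Y(R) / x is Y(R) / eps, which converges, divided by (R - r) / eps^2, which
   tends to infinity. *)
{ apply lim0_ext with (fun eps => (Y eps (r eps) - Y eps Rad) / x eps
    + Y eps Rad / eps * / ((Rad - r eps) / eps ^ 2)).
  { generalize stretched_pos; apply filter_imp; intros eps (H2 & H3 & H4).
    unfold x; field; lra. }
  replace limit_slope with (limit_slope + wall_height_rate * 0) at 1 by ring.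
  apply lim0_plus; [exact height_increment_lim|].
  apply lim0_mult; [exact wall_height_lim|now apply lim0_inv_inf]. }
assert (Hxp : at_right 0 (fun eps => 0 < x eps)).
{ generalize stretched_pos; apply filter_imp; intros eps (_ & _ & H); exact H. }
destruct (asymptotics_of_height x limit_slope Hm Hxp HY) as (H1 & H2 & H3).
split; [exact H1|split].
- apply lim0_ext with (fun eps => - (q / 2) * (Derive (U eps) (r eps) * (eps * x eps)) - 1).
  { generalize stretched_pos; apply filter_imp; intros eps (h2 & h3 & h4).
    unfold x; field; lra. }
  replace 0 with (- (q / 2) * (- (2 / q) * (limit_slope / limit_slope)) - 1) by (field; lra).
  apply lim0_minus; [now apply lim0_scal|apply lim0_const].
- apply lim0_ext with (fun eps =>
    q / (2 * g Rad) * (rho N Rad A B p q (U eps) (r eps) * x eps ^ 2) - 1).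
  { generalize stretched_pos; apply filter_imp; intros eps (h2 & h3 & h4).
    unfold x; field; lra. }
  replace 0 with (q / (2 * g Rad) * (A / limit_slope ^ 2) - 1)
    by (rewrite limit_slope_sq; field; lra).
  apply lim0_minus; [now apply lim0_scal|apply lim0_const].
Qed.

End NearWall.

Lemma asymptotics_wall_layer :
  lim0 (fun eps => (Rad - r eps) / eps ^ 2) 0 ->
  lim0 (fun eps => U eps (r eps) - (2 / q * ln eps + 2 / q * ln wall_height_rate)) 0 /\
  lim0 (fun eps => Derive (U eps) (r eps) * eps ^ 2) (- wall_slope) /\
  lim0 (fun eps => rho N Rad A B p q (U eps) (r eps) * eps ^ 2)
    (q * g Rad * wall_slope ^ 2 / 2).
Proof.
intros H0; assert (Hm := limit_slope_pos); assert (gR := g_wall_pos).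
assert (Hw := wall_slope_pos); assert (Hrate := wall_height_rate_pos).
assert (Hx : lim0 x 0).
{ apply lim0_ext with (fun eps => (Rad - r eps) / eps ^ 2 * eps).
  { generalize stretched_pos; apply filter_imp; intros eps (H2 & H3 & H4).
    unfold x; field; lra. }
  replace 0 with (0 * 0) by ring; apply lim0_mult; [exact H0|exact lim0_id]. }
assert (HY : lim0 (fun eps => Y eps (r eps) / eps) wall_height_rate).
{ apply lim0_ext with (fun eps => (Y eps (r eps) - Y eps Rad) / x eps * ((Rad - r eps) / eps ^ 2)
    + Y eps Rad / eps).
  { generalize stretched_pos; apply filter_imp; intros eps (H2 & H3 & H4).
    unfold x; field; lra. }
  replace wall_height_rate with (limit_slope * 0 + wall_height_rate) by ring.
  apply lim0_plus; [|exact wall_height_lim].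
  apply lim0_mult; [exact (height_increment_lim Hx)|exact H0]. }
destruct (asymptotics_of_height Hx (fun eps => eps) _ Hrate at_right_pos HY) as (H1 & H2 & H3).
split; [exact H1|split].
(* The slope m cancels against the one in [wall_height_rate]: U' has to leading order its prescribed
   wall value. *)
- replace (- wall_slope) with (- (2 / q) * (limit_slope / wall_height_rate))
    by (unfold wall_height_rate; field; lra).
  revert H2; apply lim0_ext, filter_forall; intros; ring.
- replace (q * g Rad * wall_slope ^ 2 / 2) with (A / wall_height_rate ^ 2); [exact H3|].
  unfold wall_height_rate; rewrite Rpow_mult_distr, limit_slope_sq; field; lra.
Qed.

(** Here the distance is much larger than eps and [layer_decay] applies directly. The divisor eps^2
    collects the 1 / eps in that bound and the division of eps w by eps. Near the wall [flux_weight]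
    stays away from 0, so a small flux means a small U'. *)
Lemma asymptotics_interior :
  lim0 r Rad ->
  tendsinf x -> (forall l, 0 < l -> lim0 (fun eps => exp (- l * x eps) / eps ^ 2) 0) ->
  lim0 (fun eps => U eps (r eps)) 0 /\ lim0 (fun eps => Derive (U eps) (r eps)) 0.
Proof.
intros HrR Hxinf Hx.
assert (fR : 0 < flux_weight Rad) by (apply flux_weight_pos; lra).
destruct layer_decay as (C & l & HC & Hl & H).
assert (Hev : eventually_layer (fun eps c K V dV => forall y, 0 < y <= Rad / 2 ->
  V (Rad - y) + eps * (flux_weight (Rad - y) * dV (Rad - y))
  <= C * (/ y + / eps) * exp (- l * y / eps))).
{ exists 1; split; [lra|]; intros eps c K V dV L _; now apply (H eps c K V dV). }
assert (Hbound : at_right 0 (fun eps =>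
  0 <= dep eps (r eps) <= 2 * C * (exp (- l * x eps) / eps ^ 2) /\
  Rabs (flux_weight (r eps) * Derive (U eps) (r eps))
  <= 2 * C * (exp (- l * x eps) / eps ^ 2))).
{ assert (Hb : at_right 0 (fun eps => 0 < r eps < Rad -> Rad / 2 <= r eps -> 1 < x eps -> eps < 1 ->
    0 <= dep eps (r eps) <= 2 * C * (exp (- l * x eps) / eps ^ 2) /\
    Rabs (flux_weight (r eps) * Derive (U eps) (r eps))
    <= 2 * C * (exp (- l * x eps) / eps ^ 2))).
  { apply (eventually_solution _ _ Hev).
    intros eps dV He L HD Hy Hre Hre2 Hx1 He1.
    specialize (Hy (Rad - r eps) ltac:(lra)).
    replace (Rad - (Rad - r eps)) with (r eps) in Hy by ring.
    replace (- l * (Rad - r eps) / eps) with (- l * x eps) in Hy by (unfold x; field; lra).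
    set (E := exp (- l * x eps)) in *.
    assert (HE : 0 < E) by apply exp_pos.
    assert (Ex : Rad - r eps = x eps * eps) by (unfold x; field; lra).
    assert (Hinv : / (Rad - r eps) <= / eps) by (apply Rinv_le_contravar; [lra|nra]).
    assert (Hie : 0 < / eps) by pos.
    assert (Hz : C * (/ (Rad - r eps) + / eps) * E <= eps * (2 * C * (E / eps ^ 2))).
    { replace (eps * (2 * C * (E / eps ^ 2))) with (C * (/ eps + / eps) * E) by (field; lra).
      apply Rmult_le_compat_r; [lra|]; apply Rmult_le_compat_l; lra. }
    assert (0 <= dep eps (r eps)) by (apply L; lra).
    assert (0 <= flux_weight (r eps) * dV (r eps)) by (apply (flux_nonneg _ _ _ _ _ L); lra).
    set (Z := 2 * C * (E / eps ^ 2)) in *.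
    assert (0 < Z) by (unfold Z; pos).
    assert (0 <= eps * (flux_weight (r eps) * dV (r eps))) by (apply Rmult_le_pos; lra).
    split; [split; [assumption|nra]|].
    replace (Derive (U eps) (r eps)) with (- dV (r eps)) by (rewrite HD by exact Hre; ring).
    rewrite <- Ropp_mult_distr_r, Rabs_Ropp, Rabs_pos_eq by assumption.
    apply Rmult_le_reg_l with eps; [exact He|lra]. }
  generalize (filter_and (F := at_right 0) _ _ (lim0_elim _ _ (Rad / 2) HrR ltac:(lra))
    (filter_and (F := at_right 0) _ _ (tendsinf_elim _ 1 Hxinf)
    (filter_and (F := at_right 0) _ _ (at_right_lt 1 Rlt_0_1)
    (filter_and (F := at_right 0) _ _ Hr Hb)))).
  apply filter_imp; intros eps (h1 & h2 & h3 & h4 & h5).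
  apply Rabs_lt_between in h1; apply h5; lra. }
assert (Hz : lim0 (fun eps => 2 * C * (exp (- l * x eps) / eps ^ 2)) 0).
{ replace 0 with (2 * C * 0) by ring; apply lim0_scal, Hx, Hl. }
split.
- apply lim0_ext with (fun eps => lev eps - dep eps (r eps)).
  { generalize Hr; apply filter_imp; intros eps h; unfold lev, dep, depth.
    rewrite clamp_id by lra; ring. }
  replace 0 with (0 - 0) by ring; apply lim0_minus; [exact equil_level_lim|].
  apply lim0_squeeze with (2 := Hz); revert Hbound; apply filter_imp; intros eps [h _].
  rewrite Rabs_pos_eq; lra.
- apply lim0_ext with (fun eps =>
    flux_weight (r eps) * Derive (U eps) (r eps) / flux_weight (r eps)).
  { generalize Hr; apply filter_imp; intros eps h.
    assert (0 < flux_weight (r eps)) by (apply flux_weight_pos; lra).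
    field; lra. }
  replace 0 with (0 / flux_weight Rad) by (field; lra).
  apply lim0_div; [lra| |].
  + apply lim0_squeeze with (2 := Hz); revert Hbound; apply filter_imp; intros eps [_ h]; exact h.
  + apply (lim0_comp flux_weight); [apply flux_weight_continuous|exact HrR].
Qed.

End Along.

(** The distance is eps exp (- phi). Divided by eps it tends to 0 because phi tends to infinity;
    divided by eps^2 it is exp (ln (1/eps) - phi), which tends to infinity because phi = o(ln
    (1/eps)). The stretched distance has logarithm exactly - phi. *)
Lemma asymptotics_exponent (b phi : R -> R) :
  at_right 0 (fun eps => b eps = 1 + phi eps / ln (1 / eps)) ->
  tendsinf phi -> lim0 (fun eps => phi eps / ln (1 / eps)) 0 ->
  lim0 (fun eps => U eps (Rad - Rpower eps (b eps)) -
    (- 2 / q * phi eps + 1 / q * ln (q * A / (2 * g Rad)))) 0 /\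
  lim0 (fun eps => Derive (U eps) (Rad - Rpower eps (b eps)) /
    (- 2 / q * Rpower eps (- b eps)) - 1) 0 /\
  lim0 (fun eps => rho N Rad A B p q (U eps) (Rad - Rpower eps (b eps)) /
    (2 * g Rad / q * Rpower eps (- 2 * (b eps - 1))) - 1) 0.
Proof.
intros Hb Hphi Hsmall; assert (gR := g_wall_pos).
set (r := fun eps => Rad - Rpower eps (b eps)).
assert (Hgood : at_right 0 (fun eps => 0 < eps /\ 0 < ln (1 / eps) /\
  Rad - r eps = eps * exp (- phi eps))).
{ generalize (filter_and (F := at_right 0) _ _ log_inv_pos Hb).
  apply filter_imp; intros e [[He HL] E]; repeat split; try assumption.
  unfold r; rewrite (Rpower_exponent _ _ _ He HL E); ring. }
assert (Hx : lim0 (fun eps => (Rad - r eps) / eps) 0).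
{ apply lim0_ext with (fun eps => exp (- phi eps)); [|now apply lim0_exp_opp].
  revert Hgood; apply filter_imp; intros e (He & HL & ->); field; lra. }
assert (Hr : at_right 0 (fun eps => 0 < r eps < Rad)).
{ generalize (filter_and (F := at_right 0) _ _ Hgood
    (filter_and (F := at_right 0) _ _ (at_right_lt 1 Rlt_0_1) (lim0_elim _ _ Rad Hx HR))).
  apply filter_imp; intros e [(He & HL & E) [He1 H]].
  assert (Hp' := exp_pos (- phi e)).
  rewrite Rminus_0_r, E in H; apply Rabs_lt_between in H.
  replace (e * exp (- phi e) / e) with (exp (- phi e)) in H by (field; lra).
  assert (0 < e * exp (- phi e)) by now apply Rmult_lt_0_compat.
  assert (e * exp (- phi e) < exp (- phi e)) by nra.
  lra. }
assert (Hinf : tendsinf (fun eps => (Rad - r eps) / eps ^ 2)).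
{ apply tendsinf_ext with (fun eps => exp ((1 - phi eps / ln (1 / eps)) * ln (1 / eps))).
  - revert Hgood; apply filter_imp; intros e (He & HL & ->).
    replace ((1 - phi e / ln (1 / e)) * ln (1 / e)) with (- ln e + - phi e)
      by (rewrite (ln_opp_log_inv e He); field; lra).
    rewrite exp_plus, exp_Ropp, exp_ln by exact He; field; lra.
  - apply tendsinf_comp; [exact filterlim_exp_infty|].
    apply tendsinf_mult with (1 - 0); [lra| |exact tendsinf_log_inv].
    apply lim0_minus; [apply lim0_const|exact Hsmall]. }
destruct (asymptotics_log_layer r Hr Hx Hinf) as (H1 & H2 & H3).
split; [|split].
- revert H1; apply lim0_ext; revert Hgood; apply filter_imp; intros e (He & HL & E).
  rewrite E; replace (e * exp (- phi e) / e) with (exp (- phi e)) by (field; lra).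
  rewrite ln_exp; unfold limit_slope; rewrite <- Rpower_sqrt by pos.
  unfold Rpower at 1; rewrite ln_exp; unfold r; field; lra.
- revert H2; apply lim0_ext; revert Hgood; apply filter_imp; intros e (He & HL & E).
  assert (0 < Rpower e (b e)) by apply exp_pos.
  rewrite Rpower_Ropp; unfold r in E |- *.
  replace (Rad - (Rad - Rpower e (b e))) with (Rpower e (b e)) by ring; field; lra.
- revert H3; apply lim0_ext; revert Hgood; apply filter_imp; intros e (He & HL & E).
  assert (Hpw : 0 < Rpower e (b e)) by apply exp_pos.
  replace (Rpower e (- 2 * (b e - 1))) with ((e / (Rad - r e)) ^ 2); [reflexivity|].
  unfold r; replace (Rad - (Rad - Rpower e (b e))) with (Rpower e (b e)) by ring.
  replace (- 2 * (b e - 1)) with (- (b e) + 1 + (- (b e) + 1)) by ring.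
  rewrite !Rpower_plus, Rpower_Ropp, Rpower_1 by exact He; field; lra.
Qed.

End Asymptotics.

End BoundaryLayer.

(** * Power-law and logarithmic distances to the wall *)

Theorem theorem5p2 (N : nat) (Rad : R) (g : R -> R) (A B p q : R)
  (U : R -> R -> R) :
  (2 <= N)%nat -> 0 < Rad ->
  smooth g -> (forall x, 0 <= x <= Rad -> 0 < g x) ->
  0 < A -> A < B -> 0 < p -> 0 < q ->
  (forall eps, 0 < eps -> solves_Nstar N Rad g A B p q eps (U eps)) ->
  (* Part (I) *)
  (forall (r : R -> R) (beta0 : R),
     (forall eps, 0 < eps -> 0 < r eps < Rad) ->
     1 < beta0 ->
     (forall b', 1 < b' < beta0 ->
        tends0 (fun eps => (Rad - r eps) / Rpower eps b')) ->
     (forall b'', beta0 < b'' ->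
        tendsinf (fun eps => (Rad - r eps) / Rpower eps b'')) ->
     (tends0 (fun eps => (Rad - r eps) / Rpower eps beta0) \/
      tendsinf (fun eps => (Rad - r eps) / Rpower eps beta0)) ->
     (* (a) *)
     ((beta0 < 2 \/
       (beta0 = 2 /\ tendsinf (fun eps => (Rad - r eps) / Rpower eps 2))) ->
      tends0 (fun eps => U eps (r eps) -
        (- 2 / q * (beta0 - 1) * ln (1 / eps)
         + 2 / q * ln ((Rad - r eps) / Rpower eps beta0)
         + 2 / q * ln (sqrt (q * A / (2 * g Rad))))) /\
      tends0 (fun eps => Derive (U eps) (r eps) / (- 2 / (q * (Rad - r eps))) - 1) /\
      tends0 (fun eps => rho N Rad A B p q (U eps) (r eps) /
        (2 * g Rad / q * (eps / (Rad - r eps)) ^ 2) - 1)) /\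
     (* (b) *)
     ((2 < beta0 \/
       (beta0 = 2 /\ tends0 (fun eps => (Rad - r eps) / Rpower eps 2))) ->
      tends0 (fun eps => U eps (r eps) -
        (- 2 / q * ln (1 / eps)
         + 2 / q * ln (sqrt (A / (2 * q * g Rad)) *
                       (2 * INR N * g Rad / (Rad * (B - A)))))) /\
      tends0 (fun eps => Derive (U eps) (r eps) /
        (- (Rad * (B - A)) / (INR N * g Rad) * / eps ^ 2) - 1) /\
      tends0 (fun eps => rho N Rad A B p q (U eps) (r eps) /
        (q * Rad ^ 2 * (B - A) ^ 2 / (2 * INR N ^ 2 * g Rad) * / eps ^ 2) - 1)))
  /\
  (* Part (II) *)
  (forall (Theta gamma tau : R) (n : nat),
     0 < Theta < 1 -> 0 < gamma -> (2 <= n)%nat ->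
     let L := fun eps => ln (1 / eps) in
     let kap := fun eps => 1 - Rpower (L eps) (- Theta) in
     let b1 := fun eps => 1 + gamma * Rpower (L eps) (- Theta) in
     let b2 := fun eps => 1 + / L eps * (gamma * iter_ln n (1 / eps) + tau) in
     (forall kappa beta, 0 < kappa < 1 -> 1 < beta ->
        at_right 0 (fun eps =>
          (Rad - Rpower eps kappa <= Rad - Rpower eps (kap eps) <= Rad - Rpower eps beta) /\
          (Rad - Rpower eps kappa <= Rad - Rpower eps (b1 eps) <= Rad - Rpower eps beta) /\
          (Rad - Rpower eps kappa <= Rad - Rpower eps (b2 eps) <= Rad - Rpower eps beta))) /\
     tends0 (fun eps => Rabs (U eps (Rad - Rpower eps (kap eps)))) /\
     tends0 (fun eps => Rabs (Derive (U eps) (Rad - Rpower eps (kap eps)))) /\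
     tends0 (fun eps => U eps (Rad - Rpower eps (b1 eps)) -
       (- 2 * gamma / q * Rpower (L eps) (1 - Theta)
        + 1 / q * ln (q * A / (2 * g Rad)))) /\
     tends0 (fun eps => U eps (Rad - Rpower eps (b2 eps)) -
       (- 2 * gamma / q * iter_ln n (1 / eps)
        + 1 / q * (- 2 * tau + ln (q * A / (2 * g Rad))))) /\
     tends0 (fun eps => Derive (U eps) (Rad - Rpower eps (b1 eps)) /
       (- 2 / q * Rpower eps (- b1 eps)) - 1) /\
     tends0 (fun eps => rho N Rad A B p q (U eps) (Rad - Rpower eps (b1 eps)) /
       (2 * g Rad / q * Rpower eps (- 2 * (b1 eps - 1))) - 1) /\
     (n = 2%nat -> 2 < gamma ->
       tends0 (fun eps => Derive (U eps) (Rad - Rpower eps (b2 eps)) /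
         (- 2 / q * Rpower eps (- b2 eps)) - 1) /\
       tends0 (fun eps => rho N Rad A B p q (U eps) (Rad - Rpower eps (b2 eps)) /
         (2 * g Rad / q * Rpower eps (- 2 * (b2 eps - 1))) - 1))).
Proof.
intros HN HR Hg Hgpos HA HAB Hp Hq HU.
assert (gR : 0 < g Rad) by (apply Hgpos; lra).
assert (N0 : 0 < INR N) by (apply lt_0_INR; lia).
split.
- intros r beta0 Hr Hbeta Hlow Hhigh _.
  assert (Hr' : at_right 0 (fun eps => 0 < r eps < Rad)).
  { generalize at_right_pos; apply filter_imp; exact Hr. }
  assert (P2 : forall eps, 0 < eps -> Rpower eps 2 = eps ^ 2).
  { intros eps He; rewrite <- (Rpower_pow 2) by exact He; f_equal; simpl; ring. }
  split.
  + intros Hcase.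
    assert (Hinf : tendsinf (fun eps => (Rad - r eps) / eps ^ 2)).
    { apply tendsinf_ext with (fun eps => (Rad - r eps) / Rpower eps 2).
      - generalize at_right_pos; apply filter_imp; intros eps He; now rewrite P2.
      - destruct Hcase as [H|[_ H]]; [now apply Hhigh|exact H]. }
    (* Any exponent strictly between 1 and [beta0] works: (R - r) / eps is the product of (R - r) /
       eps^b and eps^(b-1), both tending to 0. *)
    set (b := (1 + beta0) / 2).
    assert (Hx : lim0 (fun eps => (Rad - r eps) / eps) 0).
    { apply lim0_ext with (fun eps => (Rad - r eps) / Rpower eps b * Rpower eps (b - 1)).
      - generalize at_right_pos; apply filter_imp; intros eps He.
        replace b with (1 + (b - 1)) at 1 by ring; rewrite Rpower_plus, Rpower_1 by exact He.
        assert (0 < Rpower eps (b - 1)) by apply exp_pos. field; lra.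
      - replace 0 with (0 * 0) by ring; apply lim0_mult.
        + apply Hlow; unfold b; lra.
        + apply lim0_Rpower; unfold b; lra. }
    destruct (asymptotics_log_layer N Rad g A B p q HN HR Hg Hgpos HA HAB Hp Hq U HU r Hr' Hx Hinf)
      as (H1 & H2 & H3).
    split; [|split; [exact H2|exact H3]].
    revert H1; apply lim0_ext; generalize at_right_pos; apply filter_imp; intros eps He.
    (* The terms with [beta0] cancel: the two logarithms combine to ln ((R - r) / eps). *)
    assert (Hre := Hr eps He); f_equal; unfold limit_slope.
    rewrite !ln_div by (try apply exp_pos; lra); unfold Rpower; rewrite ln_exp, ln_1; field; lra.
  + intros Hcase.
    assert (H0 : lim0 (fun eps => (Rad - r eps) / eps ^ 2) 0).
    { apply lim0_ext with (fun eps => (Rad - r eps) / Rpower eps 2).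
      - generalize at_right_pos; apply filter_imp; intros eps He; now rewrite P2.
      - destruct Hcase as [H|[_ H]]; [apply Hlow; lra|exact H]. }
    destruct (asymptotics_wall_layer N Rad g A B p q HN HR Hg Hgpos HA HAB Hp Hq U HU r Hr' H0)
      as (H1 & H2 & H3).
    assert (HBA : 0 < B - A) by lra.
    assert (Erate : wall_height_rate N Rad g A B q =
      sqrt (A / (2 * q * g Rad)) * (2 * INR N * g Rad / (Rad * (B - A)))).
    { unfold wall_height_rate, limit_slope, wall_slope.
      (* Pulling q out of the root cancels the q in the denominator of [wall_height_rate]. *)
      replace (q * A / (2 * g Rad)) with (q ^ 2 * (A / (2 * q * g Rad))) by (field; lra).
      rewrite sqrt_mult_alt, sqrt_pow2 by (try apply pow2_ge_0; lra); field; repeat split; lra. }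
    rewrite Erate in H1.
    split; [|split].
    * revert H1; apply lim0_ext; generalize at_right_pos; apply filter_imp; intros eps He.
      f_equal; rewrite (ln_opp_log_inv eps He); field; lra.
    * apply lim0_ext with (fun eps =>
        - (INR N * g Rad / (Rad * (B - A))) * (Derive (U eps) (r eps) * eps ^ 2) - 1).
      { generalize at_right_pos; apply filter_imp; intros eps He; field; repeat split; lra. }
      replace 0 with (- (INR N * g Rad / (Rad * (B - A))) * - wall_slope N Rad g A B - 1)
        by (unfold wall_slope; field; repeat split; lra).
      apply lim0_minus; [now apply lim0_scal|apply lim0_const].
    * apply lim0_ext with (fun eps => 2 * INR N ^ 2 * g Rad / (q * Rad ^ 2 * (B - A) ^ 2)
        * (rho N Rad A B p q (U eps) (r eps) * eps ^ 2) - 1).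
      { generalize at_right_pos; apply filter_imp; intros eps He; field; repeat split; lra. }
      replace 0 with (2 * INR N ^ 2 * g Rad / (q * Rad ^ 2 * (B - A) ^ 2)
        * (q * g Rad * wall_slope N Rad g A B ^ 2 / 2) - 1)
        by (unfold wall_slope; field; repeat split; lra).
      apply lim0_minus; [now apply lim0_scal|apply lim0_const].
- intros Theta gamma tau n HTheta Hgamma Hn L kap b1 b2.
  (* Since L^(- Theta) = s / L, the exponents [kap] and [b1] have the form 1 + phi / L with phi = -
     s and phi = gamma s. *)
  set (s := fun eps => Rpower (L eps) (1 - Theta)).
  assert (Hs : tendsinf s) by (apply log_power_inf; lra).
  assert (HLT : lim0 (fun eps => Rpower (L eps) (- Theta)) 0) by (apply log_power_lim; lra).
  assert (EL : at_right 0 (fun eps => Rpower (L eps) (- Theta) = s eps / L eps)).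
  { generalize log_inv_pos; apply filter_imp; intros eps [_ HL]; fold (L eps) in HL.
    unfold s; replace (1 - Theta) with (1 + - Theta) by ring.
    rewrite Rpower_plus, Rpower_1 by exact HL; field; lra. }
  set (phi1 := fun eps => gamma * s eps).
  set (phi2 := fun eps => gamma * iter_ln n (1 / eps) + tau).
  assert (E1 : at_right 0 (fun eps => b1 eps = 1 + phi1 eps / ln (1 / eps))).
  { revert EL; apply filter_imp; intros eps E; unfold b1, phi1; rewrite E.
    unfold L, Rdiv; ring. }
  assert (E2 : at_right 0 (fun eps => b2 eps = 1 + phi2 eps / ln (1 / eps))).
  { apply filter_forall; intros eps; unfold b2, phi2, L, Rdiv; ring. }
  assert (I1 : tendsinf phi1) by (apply tendsinf_mult with gamma; [exact Hgamma|apply lim0_const|exact Hs]).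
  assert (I2 : tendsinf phi2).
  { apply tendsinf_intro; intros M.
    generalize (tendsinf_elim _ ((M - tau) / gamma) (iter_ln_inf n)); apply filter_imp; intros eps H.
    unfold phi2; apply (Rmult_lt_compat_l gamma) in H; [|exact Hgamma].
    replace (gamma * ((M - tau) / gamma)) with (M - tau) in H by (field; lra); lra. }
  assert (S0 : lim0 (fun eps => s eps / L eps) 0) by (revert HLT; apply lim0_ext; exact EL).
  assert (S1 : lim0 (fun eps => phi1 eps / ln (1 / eps)) 0).
  { apply lim0_ext with (fun eps => gamma * (s eps / L eps)).
    - apply filter_forall; intros eps; unfold phi1, L, Rdiv; ring.
    - replace 0 with (gamma * 0) by ring; now apply lim0_scal. }
  assert (S2 : lim0 (fun eps => phi2 eps / ln (1 / eps)) 0).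
  { apply lim0_ext with
      (fun eps => gamma * (iter_ln n (1 / eps) / ln (1 / eps)) + tau * / ln (1 / eps)).
    - apply filter_forall; intros eps; unfold phi2, Rdiv; ring.
    - replace 0 with (gamma * 0 + tau * 0) by ring; apply lim0_plus; apply lim0_scal.
      + now apply iter_ln_small.
      + apply lim0_inv_inf, tendsinf_log_inv. }
  assert (to_1 : forall b phi, at_right 0 (fun eps => b eps = 1 + phi eps / ln (1 / eps)) ->
    lim0 (fun eps => phi eps / ln (1 / eps)) 0 -> lim0 b 1).
  { intros b phi E H; apply lim0_ext with (fun eps => 1 + phi eps / ln (1 / eps)).
    - revert E; apply filter_imp; intros eps E; symmetry; exact E.
    - generalize (lim0_plus _ _ _ _ (lim0_const 1) H); rewrite Rplus_0_r; exact (fun h => h). }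
  assert (Hrange : forall b, lim0 b 1 -> forall kappa beta, 0 < kappa < 1 -> 1 < beta ->
    at_right 0 (fun eps => Rad - Rpower eps kappa <= Rad - Rpower eps (b eps) <= Rad - Rpower eps beta)).
  { intros b Hb kappa beta Hk Hbe.
    generalize (filter_and (F := at_right 0) _ _ log_inv_pos
      (filter_and (F := at_right 0) _ _ (lim0_elim _ _ (1 - kappa) Hb ltac:(lra))
        (lim0_elim _ _ (beta - 1) Hb ltac:(lra)))).
    apply filter_imp; intros eps ([He HL] & h1 & h2).
    apply Rabs_lt_between in h1; apply Rabs_lt_between in h2.
    apply Rpower_between; try assumption; lra. }
  assert (Hkap : lim0 kap 1).
  { replace 1 with (1 - 0) by ring; apply lim0_minus; [apply lim0_const|exact HLT]. }
  (* The stretched distance is exp s, which tends to infinity: this point lies outside the layer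
     although it approaches the wall. *)
  assert (Ekap : at_right 0 (fun eps => 0 < eps /\ Rpower eps (kap eps) = eps * exp (s eps))).
  { generalize (filter_and (F := at_right 0) _ _ log_inv_pos EL).
    apply filter_imp; intros eps [[He HL] E]; split; [exact He|].
    replace (s eps) with (- (- s eps)) by ring; apply Rpower_exponent; try assumption.
    unfold kap; rewrite E; unfold L, Rdiv; ring. }
  assert (Rkap : lim0 (fun eps => Rpower eps (kap eps)) 0).
  (* The distance eps exp s equals exp (s - L), and s = o(L). *)
  { apply lim0_ext with (fun eps => exp (- ((1 - s eps / L eps) * L eps))).
    - generalize (filter_and (F := at_right 0) _ _ log_inv_pos Ekap).
      apply filter_imp; intros eps [[_ HL] [He ->]]; fold (L eps) in HL.
      replace (- ((1 - s eps / L eps) * L eps)) with (- L eps + s eps) by (field; lra).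
      unfold L; rewrite <- (ln_opp_log_inv eps He), exp_plus, exp_ln by exact He; reflexivity.
    - apply lim0_exp_opp, tendsinf_mult with (1 - 0); [lra| |exact tendsinf_log_inv].
      apply lim0_minus; [apply lim0_const|exact S0]. }
  destruct (asymptotics_interior N Rad g A B p q HN HR Hg Hgpos HA HAB Hp Hq U HU
    (fun eps => Rad - Rpower eps (kap eps))) as [K1 K2].
  { generalize (lim0_elim _ _ Rad Rkap HR); apply filter_imp; intros eps H.
    rewrite Rminus_0_r in H; apply Rabs_lt_between in H.
    assert (0 < Rpower eps (kap eps)) by apply exp_pos; lra. }
  { generalize (lim0_minus _ _ _ _ (lim0_const Rad) Rkap); rewrite Rminus_0_r; exact (fun h => h). }
  { apply tendsinf_ext with (fun eps => exp (s eps)).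
    - revert Ekap; apply filter_imp; intros eps [He ->]; field; lra.
    - apply tendsinf_comp; [exact filterlim_exp_infty|exact Hs]. }
  { intros l Hl; apply lim0_ext with (fun eps => exp (- l * exp (s eps)) / eps ^ 2).
    - revert Ekap; apply filter_imp; intros eps [He ->].
      replace ((Rad - (Rad - eps * exp (s eps))) / eps) with (exp (s eps)) by (field; lra).
      reflexivity.
    - apply exp_log_power_dominates; lra. }
  destruct (asymptotics_exponent N Rad g A B p q HN HR Hg Hgpos HA HAB Hp Hq U HU b1 phi1 E1 I1 S1)
    as (A1 & A2 & A3).
  destruct (asymptotics_exponent N Rad g A B p q HN HR Hg Hgpos HA HAB Hp Hq U HU b2 phi2 E2 I2 S2)
    as (B1 & B2 & B3).
  assert (abs0 : forall f, lim0 f 0 -> tends0 (fun eps => Rabs (f eps))).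
  { intros f Hf; generalize (lim0_comp Rabs f 0 (continuous_Rabs 0) Hf).
    rewrite Rabs_R0; exact (fun h => h). }
  split; [|split; [|split; [|split; [|split; [|split; [|split]]]]]].
  + intros kappa beta Hk Hb; apply filter_and; [|apply filter_and]; apply Hrange; try assumption.
    * exact (to_1 b1 phi1 E1 S1).
    * exact (to_1 b2 phi2 E2 S2).
  + exact (abs0 _ K1).
  + exact (abs0 _ K2).
  + revert A1; apply lim0_ext, filter_forall; intros eps; unfold phi1, s; field; lra.
  + revert B1; apply lim0_ext, filter_forall; intros eps; unfold phi2; field; lra.
  + exact A2.
  + exact A3.
  + intros _ _; split; [exact B2|exact B3].
Qed.
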